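(* Assume the setting, Assumptions 1–2 and the FedAvg algorithm of the context, with $T$ a multiple of $I$, stepsize $\eta=\sqrt{bK/T}$, and $T\ge81L^2I^2bK$. Then for any $b\ge1$ and $I\ge1$, $$\mathbb{E}\|\nabla f(\bar x_a)\|^2\le\frac{2(f(\bar x_1)-f^\ast)}{(bK)^{1/2}T^{1/2}}+\frac{2L\sigma^2}{(bK)^{1/2}T^{1/2}}+\frac{3L^2bK(I-1)}{T}\sigma^2+\frac{5L^2bK(I-1)^2}{T}\zeta^2.$$
   Context: Setting: $K\ge1$ worker nodes. For each $k$, $f^{(k)}(x)=\mathbb{E}_{\xi\sim\mathcal{D}^{(k)}}[f^{(k)}(x;\xi)]$. The objective is $f=\frac1K\sum_kf^{(k)}$, with $f^\ast=\inf f>-\infty$. Assumption 1: $\mathbb{E}\|\nabla f^{(k)}(x;\xi)-\nabla f^{(k)}(y;\xi)\|^2\le L^2\|x-y\|^2$. Assumption 2: $\mathbb{E}[\nabla f^{(k)}(x;\xi)]=\nabla f^{(k)}(x)$, $\mathbb{E}\|\nabla f^{(k)}(x;\xi)-\nabla f^{(k)}(x)\|^2\le\sigma^2$, and $\|\nabla f^{(k)}(x)-\nabla f^{(\ell)}(x)\|^2\le\zeta^2$. Samples are i.i.d., independent across nodes and of the past. FedAvg algorithm. Initialization: $x_1^{(k)}=\bar x_1$ for all $k$. For $t=1,\dots,T$: $d_t^{(k)}=\frac1b\sum_{\xi\in\mathcal{B}_t^{(k)}}\nabla f^{(k)}(x_t^{(k)};\xi)$ with a fresh size-$b$ minibatch,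 and $x_{t+1}^{(k)}=x_t^{(k)}-\eta d_t^{(k)}$. If $t\bmod I=0$, replace $x_{t+1}^{(k)}$ by $\bar x_{t+1}=\frac1K\sum_jx_{t+1}^{(j)}$ for all $k$. Here $\bar x_t=\frac1K\sum_kx_t^{(k)}$. Output: $\bar x_a$, uniform on $\{\bar x_t\}_{t=1}^T$. *)

(* Defs.v *)
From HB Require Import structures.
From mathcomp Require Import all_boot all_order all_algebra.
From mathcomp Require Import all_classical all_reals all_analysis.
Set Implicit Arguments. Unset Strict Implicit. Unset Printing Implicit Defensive.
Import Order.TTheory GRing.Theory Num.Theory.
Import numFieldNormedType.Exports.
Local Open Scope classical_set_scope.
Local Open Scope ring_scope.

Section FedAvgDefs.
Variables (R : realType) (d : nat).

Definition dotv (u v : 'rV[R]_d) : R := \sum_(i < d) u 0 i * v 0 i.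
Definition sqnorm (v : 'rV[R]_d) : R := \sum_(i < d) (v 0 i) ^+ 2.

Definition has_gradient (h : 'rV[R]_d -> R) (g : 'rV[R]_d -> 'rV[R]_d) : Prop :=
  forall x, differentiable h x /\ forall v, 'd h x v = dotv (g x) v.

Definition avgK (K : nat) (y : 'I_K -> 'rV[R]_d) : 'rV[R]_d :=
  K%:R^-1 *: \sum_(k < K) y k.

Definition fglob (K : nat) (fk : 'I_K -> 'rV[R]_d -> R) (x : 'rV[R]_d) : R :=
  K%:R^-1 * \sum_(k < K) fk k x.

(* FedAvg iterates.  Index t : nat here corresponds to the paper's t+1:
   fedavg ... 0 k = x_1^(k) = x1bar, and fedavg ... t k = x_{t+1}^(k).
   s t k j is the j-th sample of the minibatch B_{t+1}^(k) of node k. *)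
Fixpoint fedavg (X : Type) (K b I : nat) (eta : R)
    (g : 'I_K -> 'rV[R]_d -> X -> 'rV[R]_d) (x1 : 'rV[R]_d)
    (s : nat -> 'I_K -> 'I_b -> X) (t : nat) : 'I_K -> 'rV[R]_d :=
  match t with
  | 0 => fun _ => x1
  | t'.+1 =>
      let xt := @fedavg X K b I eta g x1 s t' in
      let y := fun k => xt k - eta *: (b%:R^-1 *: \sum_(j < b) g k (xt k) (s t' k j)) in
      if (t'.+1 %% I == 0)%N then (fun _ => avgK y) else y
  end.

End FedAvgDefs.

(* Main.v *)
Require Import Defs.
From HB Require Import structures.
From mathcomp Require Import all_boot all_order all_algebra.
From mathcomp Require Import all_classical all_reals all_analysis.
From mathcomp Require Import measurable_realfun ring lra.
Set Implicit Arguments.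
Unset Strict Implicit.
Unset Printing Implicit Defensive.
Import Order.TTheory GRing.Theory Num.Theory.
Import numFieldNormedType.Exports.
Local Open Scope classical_set_scope.
Local Open Scope ring_scope.

(** The averaged iterates perform a gradient step with the mean of the
    minibatch gradients.  Smoothness of [f] turns this into a descent
    inequality, which is telescoped pathwise before taking expectations, so
    that integrability of [f] along the iterates is never needed.  It leaves
    two error terms: the mean noise, of second moment at most
    [sigma^2 / (b K)] because distinct sample noises are orthogonal, and the
    consensus error [1/K sum_k |x_t^(k) - xbar_t|^2].  Within a communication
    round the latter is at most the mean square distance to the reference point
    [xbar_(sI) - eta sum_r grad f (xbar_r)], and splitting into noise, drift
    and heterogeneity gives a recursion that closes as [9 eta L I <= 1].

    Orthogonality is Fubini's theorem: the identity of [Omega], seen as a map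
    to [Omega] with the sigma-algebra generated by all samples but one, is
    independent of the remaining sample.  The joint measurability of the
    stochastic gradient comes from that of [F], which is measurable in the
    sample and continuous in the point, the gradient being a limit of
    difference quotients. *)

(** * Independence from a generated sigma-algebra *)

Section independence.
Context d dX (Omega : measurableType d) (X : measurableType dX) (R : realType).
Variables (P : probability Omega R) (D : probability X R).
Variables (G : set (set Omega)) (Y : Omega -> X).
Hypothesis setIG : setI_closed G.
Hypothesis GT : G setT.
Hypothesis mG : G `<=` measurable.
Hypothesis mY : measurable_fun setT Y.
Hypothesis indepGY : forall A B, G A -> measurable B ->
  P (A `&` Y @^-1` B) = (P A * D B)%E.

Local Notation E := [the measurableType _ of g_sigma_algebraType G].

Let mYB B : measurable B -> measurable (Y @^-1` B).
Proof. by move=> mB; rewrite -[X in measurable X]setTI; exact: mY. Qed.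

Lemma measurable_g_sigma_algebra_sub (A : set E) :
  measurable A -> measurable (A : set Omega).
Proof. by apply: smallest_sub => //; exact: sigma_algebra_measurable. Qed.

Lemma measurable_fun_g_sigma_algebra_sub d' (U : measurableType d') (f : E -> U) :
  measurable_fun setT f -> measurable_fun setT (f : Omega -> U).
Proof.
by move=> mf _ B mB; apply: measurable_g_sigma_algebra_sub; exact: mf.
Qed.

(** For fixed [B] both sides are finite measures in [A]. They agree on the pi-system [G], which
    contains [setT], hence on the sigma-algebra it generates. *)
Lemma independent_g_sigma_algebra (A : set E) (B : set X) :
  measurable A -> measurable B -> P (A `&` Y @^-1` B) = (P A * D B)%E.
Proof.
move=> mA mB.
have DBge0 : 0 <= fine (D B) by apply: fine_ge0.
pose m1 := mrestr P (mYB mB).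
pose m2 := mscale (NngNum DBge0) P.
have -> : P (A `&` Y @^-1` B) = m1 A by [].
have -> : (P A * D B)%E = m2 A.
  by rewrite /m2 /mscale/= fineK ?fin_num_measure// muleC.
apply: (@g_sigma_algebra_measure_unique _ _ _ G _ (fun=> setT)) => //.
- by rewrite bigcup_const.
- move=> C GC; transitivity (P (C `&` Y @^-1` B)) => //.
  rewrite indepGY// muleC; congr (_ * _)%E => //=.
  by rewrite fineK ?fin_num_measure.
- move=> _; rewrite /m1 /mrestr.
  by rewrite (le_lt_trans (probability_le1 _ _)) ?ltry//; apply: measurableI => //; exact: mYB.
Qed.

Let idE : Omega -> E := id.
Let midE : measurable_fun setT idE.
Proof. exact: (@measurable_fun_g_sigma_algebra_sub _ E id). Qed.
HB.instance Definition _ := @isMeasurableFun.Build _ _ Omega E idE midE.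

Let pairY : Omega -> E * X := fun w => (w, Y w).
Let mpairY : measurable_fun setT pairY.
Proof. exact: measurable_fun_pair. Qed.
HB.instance Definition _ := @isMeasurableFun.Build _ _ Omega (E * X)%type pairY mpairY.

Let Q : probability E R := distribution P idE.

(** Rectangles determine a product measure, so independence fixes the joint law of [w], seen in the
    coarser sigma-algebra, and [Y w]. *)
Let joint_law (C : set (E * X)) : measurable C ->
  distribution P pairY C = (Q \x D)%E C.
Proof.
move=> mC; apply/esym/product_measure_unique => // A B mA mB.
rewrite -[RHS]independent_g_sigma_algebra//.
Qed.

Lemma integral_independent_ge0 (phi : E * X -> \bar R) :
  measurable_fun setT phi -> (forall u, 0 <= phi u)%E ->
  (\int[P]_w phi (w, Y w) = \int[P]_w \int[D]_z phi (w, z))%E.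
Proof.
move=> mphi phi0.
transitivity (\int[distribution P pairY]_u phi u)%E.
  by rewrite ge0_integral_distribution.
transitivity (\int[Q \x D]_u phi u)%E.
  by apply: eq_measure_integral => A mA _; exact: joint_law.
rewrite fubini_tonelli1// /Q ge0_integral_distribution//.
  exact: measurable_fun_fubini_tonelli_F.
by move=> w; exact: integral_ge0.
Qed.

(** The signed version: integrability on [Omega] passes to the joint law, so Fubini applies, and
    every inner integral vanishes. *)
Lemma integral_independent_eq0 (phi : E * X -> R) :
  measurable_fun setT phi -> P.-integrable setT (fun w => (phi (w, Y w))%:E) ->
  (forall w, \int[D]_z (phi (w, z))%:E = 0)%E ->
  (\int[P]_w (phi (w, Y w))%:E = 0)%E.
Proof.
move=> mphi iphi phi0.
have mEphi : measurable_fun setT (EFin \o phi) by exact/measurable_EFinP.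
have -> : (\int[P]_w (phi (w, Y w))%:E = \int[distribution P pairY]_u (phi u)%:E)%E.
  by rewrite integral_distribution.
have eqQ (h : E * X -> \bar R) :
    (\int[distribution P pairY]_u h u = \int[Q \x D]_u h u)%E.
  by apply: eq_measure_integral => A mA _; exact: joint_law.
have iQ : (Q \x D)%E.-integrable setT (EFin \o phi).
  have /integrableP[_] : (distribution P pairY).-integrable setT (EFin \o phi).
    exact: integrable_pushforward.
  by rewrite eqQ => phioo; exact/integrableP.
rewrite eqQ -integral12_prod_meas1// -[RHS](@integral0 _ _ _ Q setT).
by apply: eq_integral => w _; exact: phi0.
Qed.
End independence.

(** * Euclidean geometry and smoothness *)

Section dotv_theory.
Context (R : realType) (d : nat).
Implicit Types u v w c : 'rV[R]_d.

Lemma sqnormE u : sqnorm u = dotv u u.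
Proof. by apply: eq_bigr => i _; rewrite expr2. Qed.

Lemma dotvC u v : dotv u v = dotv v u.
Proof. by apply: eq_bigr => i _; rewrite mulrC. Qed.

Lemma dotvDl u v w : dotv (u + v) w = dotv u w + dotv v w.
Proof. by rewrite -big_split; apply: eq_bigr => i _; rewrite mxE mulrDl. Qed.

Lemma dotvZl a u w : dotv (a *: u) w = a * dotv u w.
Proof. by rewrite /dotv mulr_sumr; apply: eq_bigr => i _; rewrite mxE mulrA. Qed.

Lemma dotvNl u w : dotv (- u) w = - dotv u w.
Proof. by rewrite -scaleN1r dotvZl mulN1r. Qed.

Lemma dotv0l w : dotv 0 w = 0.
Proof. by rewrite -(scale0r 0) dotvZl mul0r. Qed.

Lemma dotvDr u v w : dotv w (u + v) = dotv w u + dotv w v.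
Proof. by rewrite !(dotvC w) dotvDl. Qed.

Lemma dotvZr a u w : dotv w (a *: u) = a * dotv w u.
Proof. by rewrite !(dotvC w) dotvZl. Qed.

Lemma dotvNr u w : dotv w (- u) = - dotv w u.
Proof. by rewrite !(dotvC w) dotvNl. Qed.

Lemma dotv_suml I (r : seq I) (Q : pred I) (F : I -> 'rV[R]_d) w :
  dotv (\sum_(i <- r | Q i) F i) w = \sum_(i <- r | Q i) dotv (F i) w.
Proof.
apply: (big_morph (fun u => dotv u w)); last exact: dotv0l.
by move=> u v; exact: dotvDl.
Qed.

Lemma dotv_sumr I (r : seq I) (Q : pred I) (F : I -> 'rV[R]_d) w :
  dotv w (\sum_(i <- r | Q i) F i) = \sum_(i <- r | Q i) dotv w (F i).
Proof.
by rewrite dotvC dotv_suml; apply: eq_bigr => i _; rewrite dotvC.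
Qed.

Lemma sqnorm_ge0 u : 0 <= sqnorm u.
Proof. by apply: sumr_ge0 => i _; exact: sqr_ge0. Qed.

Lemma sqnormZ a u : sqnorm (a *: u) = a ^+ 2 * sqnorm u.
Proof. by rewrite !sqnormE dotvZl dotvZr mulrA. Qed.

Lemma sqnormN u : sqnorm (- u) = sqnorm u.
Proof. by rewrite -scaleN1r sqnormZ sqrrN expr1n mul1r. Qed.

Lemma sqnormD u v : sqnorm (u + v) = sqnorm u + 2 * dotv u v + sqnorm v.
Proof. rewrite !sqnormE dotvDl !dotvDr (dotvC v u); ring. Qed.

Lemma sqnormB u v : sqnorm (u - v) = sqnorm u - 2 * dotv u v + sqnorm v.
Proof. by rewrite sqnormD dotvNr sqnormN mulrN. Qed.

Lemma sqnormD_le u v : sqnorm (u + v) <= 2 * sqnorm u + 2 * sqnorm v.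
Proof.
have := sqnorm_ge0 (u - v); rewrite sqnormB sqnormD; lra.
Qed.

Lemma dotv_delta u i : dotv u (delta_mx 0 i) = u 0 i.
Proof.
rewrite /dotv (bigD1 i)//= mxE !eqxx mulr1 big1 ?addr0// => j /negPf ji.
by rewrite mxE ji andbF mulr0.
Qed.

Lemma dotv_inj u v : (forall w, dotv u w = dotv v w) -> u = v.
Proof. by move=> uv; apply/rowP => i; rewrite -!dotv_delta uv. Qed.

(** Cauchy-Schwarz without square roots: expand [0 <= sqnorm (u - a *: v)] and divide by [2 * a].
    When [a = 0] the hypothesis forces every coordinate of [u] to vanish. *)
Lemma dotv_le u v a : 0 <= a -> sqnorm u <= a ^+ 2 * sqnorm v ->
  dotv u v <= a * sqnorm v.
Proof.
rewrite le_eqVlt => /predU1P[<-|a0].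
  rewrite expr0n/= !mul0r => u0.
  have : sqnorm u == 0 by rewrite eq_le u0 sqnorm_ge0.
  rewrite psumr_eq0 => [/allP u0'|i _]; last exact: sqr_ge0.
  rewrite /dotv big1// => i _.
  by have /implyP/(_ isT) := u0' i (mem_index_enum i); rewrite sqrf_eq0 => /eqP ->; rewrite mul0r.
have := sqnorm_ge0 (u - a *: v); rewrite sqnormB dotvZr sqnormZ => H1 H2.
rewrite -(ler_pM2l a0); nra.
Qed.

Lemma sum_sqnormB n (F : 'I_n -> 'rV[R]_d) c :
  \sum_(i < n) sqnorm (F i - c) =
  \sum_(i < n) sqnorm (F i) - 2 * dotv (\sum_(i < n) F i) c + n%:R * sqnorm c.
Proof.
rewrite dotv_suml.
under eq_bigr do rewrite sqnormB.
rewrite !big_split/= sumrN -big_distrr/= sumr_const card_ord.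
by rewrite [_%:R * sqnorm c]mulr_natl.
Qed.

(** The squared deviations from the mean have a nonnegative sum. For [n = 0] both sides are 0. *)
Lemma sqnorm_avgK_le n (F : 'I_n -> 'rV[R]_d) :
  sqnorm (avgK F) <= n%:R^-1 * \sum_(i < n) sqnorm (F i).
Proof.
case: n F => [|n] F; first by rewrite /avgK !big_ord0 scaler0 mulr0 sqnormE dotv0l.
have n0 : n.+1%:R != 0 :> R by rewrite pnatr_eq0.
have : 0 <= \sum_(i < n.+1) sqnorm (F i - avgK F).
  by apply: sumr_ge0 => i _; exact: sqnorm_ge0.
rewrite sum_sqnormB.
have -> : \sum_(i < n.+1) F i = n.+1%:R *: avgK F.
  by rewrite /avgK scalerA divff// scale1r.
rewrite dotvZl -sqnormE => H.
rewrite -(@ler_pM2l _ n.+1%:R) ?ltr0n// mulrA divff// mul1r.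
move: H; set a := _ * sqnorm _; lra.
Qed.

Lemma sqnorm_sum_le n (F : 'I_n -> 'rV[R]_d) :
  sqnorm (\sum_(i < n) F i) <= n%:R * \sum_(i < n) sqnorm (F i).
Proof.
case: n F => [|n] F; first by rewrite !big_ord0 mulr0 sqnormE dotv0l.
have n0 : n.+1%:R != 0 :> R by rewrite pnatr_eq0.
have -> : \sum_(i < n.+1) F i = n.+1%:R *: avgK F.
  by rewrite /avgK scalerA divff// scale1r.
rewrite sqnormZ expr2 -mulrA ler_wpM2l//.
rewrite -(@ler_pM2l _ n.+1%:R^-1) ?invr_gt0 ?ltr0n// mulrA mulVf// mul1r.
exact: sqnorm_avgK_le.
Qed.

(** The mean minimises the sum of squared distances: the gap is [n%:R * sqnorm (avgK F - c)]. *)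
Lemma sum_sqnormB_avgK_le n (F : 'I_n -> 'rV[R]_d) c :
  \sum_(i < n) sqnorm (F i - avgK F) <= \sum_(i < n) sqnorm (F i - c).
Proof.
case: n F => [|n] F; first by rewrite !big_ord0.
have n0 : n.+1%:R != 0 :> R by rewrite pnatr_eq0.
rewrite !sum_sqnormB.
have -> : \sum_(i < n.+1) F i = n.+1%:R *: avgK F.
  by rewrite /avgK scalerA divff// scale1r.
rewrite !(dotvZl n.+1%:R) -sqnormE -!addrA lerD2l.
have : 0 <= n.+1%:R * sqnorm (avgK F - c).
  by rewrite mulr_ge0// sqnorm_ge0.
rewrite sqnormB; lra.
Qed.

Lemma avgKB n (F G : 'I_n -> 'rV[R]_d) :
  avgK (fun i => F i - G i) = avgK F - avgK G.
Proof. by rewrite /avgK sumrB scalerBr. Qed.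

Lemma avgKZ n a (F : 'I_n -> 'rV[R]_d) :
  avgK (fun i => a *: F i) = a *: avgK F.
Proof. rewrite /avgK -scaler_sumr !scalerA; congr (_ *: _); exact: mulrC. Qed.

Lemma avgK_cst n (c : 'rV[R]_d) : (0 < n)%N -> avgK (fun _ : 'I_n => c) = c.
Proof.
move=> n0; rewrite /avgK sumr_const card_ord -[c *+ n]scaler_nat scalerA mulVf ?scale1r//.
by rewrite pnatr_eq0 -lt0n.
Qed.

End dotv_theory.

Section smooth.
Context (R : realType) (d : nat).
Implicit Types (h : 'rV[R]_d -> R) (g : 'rV[R]_d -> 'rV[R]_d).

Lemma has_gradient_is_derive h g (x v : 'rV[R]_d) (s : R) : has_gradient h g ->
  is_derive s 1 (fun s => h (x + s *: v)) (dotv (g (x + s *: v)) v).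
Proof.
move=> hg; have [dh dhE] := hg (x + s *: v).
pose l : R -> 'rV[R]_d := cst x + ( *:%R^~ v).
have dl : is_diff s l (0 + ( *:%R^~ v)) by apply: is_diffD.
have dhl : differentiable (h \o l) s by exact: differentiable_comp.
apply: DeriveDef; first by apply/derivable1_diffP.
rewrite -/(h \o l) deriveE// diff_comp//= diff_val.
by rewrite -dhE /= -[X in 'd h _ X]/(0 + 1 *: v) add0r scale1r.
Qed.

(** Along the segment from [x] to [y], subtract the linear and quadratic terms to get [p]. Its
    derivative [dp] is nonpositive on [0, 1], so the mean value theorem gives [p 1 <= p 0], which is
    the claim. *)
Lemma smooth_le h g (L : R) (x y : 'rV[R]_d) : 0 <= L -> has_gradient h g ->
  (forall x y, sqnorm (g x - g y) <= L ^+ 2 * sqnorm (x - y)) ->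
  h y <= h x + dotv (g x) (y - x) + L / 2 * sqnorm (y - x).
Proof.
move=> L0 hg gL; set v := y - x.
pose p s := h (x + s *: v) - s * dotv (g x) v - L / 2 * sqnorm v * s ^+ 2.
pose dp s := dotv (g (x + s *: v)) v - dotv (g x) v - L / 2 * sqnorm v * (2 * s).
have pdp (s : R) : is_derive s 1 p (dp s).
  have ? := has_gradient_is_derive x v s hg.
  apply: is_derive_eq. rewrite /dp /GRing.scale/=; ring.
have cp : {within `[0, 1], continuous p}.
  apply: continuous_subspaceT => s; apply/differentiable_continuous.
  by apply/derivable1_diffP; exact: ex_derive.
have [s /itvP s01 ps] := MVT ltr01 (fun s _ => pdp s) cp.
have : dp s <= 0.
  have s0 : 0 <= s by rewrite s01.
  have : dotv (g (x + s *: v) - g x) v <= L * s * sqnorm v.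
    apply: dotv_le; first exact: mulr_ge0.
    by rewrite (le_trans (gL _ _))// (addrC x) addrK sqnormZ exprMn mulrA.
  rewrite dotvDl dotvNl /dp; lra.
move: ps; rewrite subr0 mulr1 /p scale1r scale0r addr0 expr1n expr0n /=.
rewrite {1}/v (addrC x) subrK; lra.
Qed.

(** Both vectors represent the derivative of [fglob fk] at [x] in every direction [w], hence
    coincide. *)
Lemma gradient_fglob K (fk : 'I_K -> 'rV[R]_d -> R) gk gf :
  (forall k, has_gradient (fk k) (gk k)) -> has_gradient (fglob fk) gf ->
  forall x, gf x = avgK (fun k => gk k x).
Proof.
move=> hk hf x; apply: dotv_inj => w.
have := has_gradient_is_derive x w 0 hf.
have dk k := has_gradient_is_derive x w 0 (hk k).
have := is_deriveZ K%:R^-1 (is_derive_sum dk).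
have -> : K%:R^-1 \*: (\sum_(k < K) (fun s => fk k (x + s *: w))) =
    (fun s => fglob fk (x + s *: w)).
  by apply/funext => s; rewrite /fglob /= fct_sumE.
move=> /@derive_val E1 /@derive_val; rewrite E1 scale0r addr0 => <-.
by rewrite /avgK dotvZl dotv_suml.
Qed.

End smooth.

(** * Joint measurability of gradients *)

Section caratheodory.
Context (R : realType) (d : nat).

(** Together with [cell], rounds each coordinate down to a multiple of 1/(n+1). The index is an
    integer vector, so the rounded point has countably many values. *)
Definition grid (n : nat) (m : 'rV[int]_d) : 'rV[R]_d :=
  \row_i ((m 0 i)%:~R / n.+1%:R).

Definition cell (n : nat) (x : 'rV[R]_d) : 'rV[int]_d :=
  \row_i Num.floor (x 0 i * n.+1%:R).

Lemma grid_cell_cvg (x : 'rV[R]_d) : grid n (cell n x) @[n --> \oo] --> x.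
Proof.
apply/cvgrPdist_lt => _/posnumP[e]; near=> n.
suff : `|x - grid n (cell n x)| <= n.+1%:R^-1.
  by move=> /le_lt_trans; apply; near: n; exact: near_infty_natSinv_lt.
have n0 : 0 < n.+1%:R :> R by rewrite ltr0n.
rewrite /Num.norm/= mx_normrE; apply: bigmax_le; first by rewrite invr_ge0 ltW.
move=> [i j] _ /=; rewrite !mxE ord1.
have /andP[] := floor_itv (x 0 j * n.+1%:R); set f := Num.floor _.
rewrite intrD => f1 f2.
rewrite ler_norml; apply/andP; split.
  apply: (@le_trans _ _ 0); first by rewrite oppr_le0 invr_ge0 ltW.
  by rewrite subr_ge0 ler_pdivrMr.
rewrite lerBlDr -[X in X + _]mul1r -mulrDl ler_pdivlMr// addrC ltW//.
Unshelve. all: by end_near. Qed.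

Context dS dX (S : measurableType dS) (X : measurableType dX).
Variables (Z : S -> 'rV[R]_d) (Y : S -> X).
Hypothesis mZ : forall i, measurable_fun setT (fun s => Z s 0 i).
Hypothesis mY : measurable_fun setT Y.

Let measurable_cell n m : measurable [set s | cell n (Z s) = m].
Proof.
have -> : [set s | cell n (Z s) = m] =
    \bigcap_(i in [set: 'I_d])
      ((fun s => Z s 0 i * n.+1%:R) @^-1` [set` `[(m 0 i)%:~R, (m 0 i + 1)%:~R[]).
  apply/seteqP; split => s /=.
    by move=> <- i _ /=; rewrite !mxE in_itv/= floor_itv.
  move=> H; apply/rowP => i; rewrite !mxE; apply: floor_def.
  by have := H i Logic.I; rewrite /= in_itv.
apply: fin_bigcap_measurable => // i _.
rewrite -[X in measurable X]setTI.
by apply: (measurable_funM (mZ i) (measurable_cst _)) => //; exact: measurable_itv.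
Qed.

Variable F : 'rV[R]_d -> X -> R.
Hypothesis mF : forall x, measurable_fun setT (F x).

(* [Z] is approximated by the countably-valued maps [grid n \o cell n \o Z]. *)
Lemma measurable_fun_caratheodory : (forall z, continuous (F^~ z)) ->
  measurable_fun setT (fun s => F (Z s) (Y s)).
Proof.
move=> cF.
apply: (@measurable_fun_cvg _ _ _ _ (fun n s => F (grid n (cell n (Z s))) (Y s))).
  move=> n _ B mB; rewrite setTI.
  (* On each cell the point is constant, so there measurability in the sample alone suffices. *)
  have -> : (fun s => F (grid n (cell n (Z s))) (Y s)) @^-1` B =
      \bigcup_m ([set s | cell n (Z s) = m] `&` (Y @^-1` (F (grid n m) @^-1` B))).
    apply/seteqP; split => s /=; first by move=> Bs; exists (cell n (Z s)).
    by move=> [m _ [/= -> ]].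
  apply: countable_bigcupT_measurable => [|m]; first exact: countableP.
  apply: measurableI => //.
  rewrite -[X in measurable X]setTI; apply: mY => //.
  by rewrite -[X in measurable X]setTI; exact: mF.
move=> s _; have := @cvg_comp _ _ _ (fun n => grid n (cell n (Z s))) (F^~ (Y s))
  \oo (nbhs (Z s)) (nbhs (F (Z s) (Y s))).
by apply; [exact: grid_cell_cvg|exact: cF].
Qed.

End caratheodory.

(** The steps 1/(n+1) are nonzero and tend to 0, so they converge in the punctured neighbourhood
    filter that defines the derivative. A sequential limit is what measurability of limits asks
    for. *)
Lemma derive_cvg_harmonic (R : realType) (V : normedModType R) (f : V -> R) (x v : V) :
  derivable f x v ->
  n.+1%:R * (f (n.+1%:R^-1 *: v + x) - f x) @[n --> \oo] --> 'D_v f x.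
Proof.
move=> fx.
have -> : (fun n => n.+1%:R * (f (n.+1%:R^-1 *: v + x) - f x)) =
    (fun h => h^-1 *: ((f \o shift x) (h *: v) - f x)) \o @harmonic R.
  by apply/funext => n; rewrite /= invrK.
apply: cvg_comp; last exact: fx.
move=> A; rewrite /dnbhs withinE => -[B B0 AB].
have hB : \forall n \near \oo, B (harmonic n) := @cvg_harmonic R _ B0.
rewrite nbhs_simpl /=; apply: filterS hB => n Bn.
have : (B `&` [set y | y != 0]) (n.+1%:R^-1 : R) by split => //=; rewrite invr_eq0 pnatr_eq0.
by rewrite -AB => -[].
Qed.

(** The source [S] is arbitrary, as the lemma serves on [Omega], on the generated sigma-algebras and
    on their products with [X]. *)
Lemma measurable_fun_gradient (R : realType) (d : nat) dS dX
    (S : measurableType dS) (X : measurableType dX) (Z : S -> 'rV[R]_d) (Y : S -> X)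
    (F : 'rV[R]_d -> X -> R) (g : 'rV[R]_d -> X -> 'rV[R]_d) :
  (forall i, measurable_fun setT (fun s => Z s 0 i)) -> measurable_fun setT Y ->
  (forall x, measurable_fun setT (F x)) ->
  (forall z, has_gradient (F^~ z) (g^~ z)) ->
  forall i, measurable_fun setT (fun s => g (Z s) (Y s) 0 i).
Proof.
move=> mZ mY mF Fg i.
have cF z : continuous (F^~ z).
  by move=> x; apply: differentiable_continuous; exact: (Fg z x).1.
pose e : 'rV[R]_d := delta_mx 0 i.
apply: (@measurable_fun_cvg _ _ _ _
  (fun n s => n.+1%:R * (F (n.+1%:R^-1 *: e + Z s) (Y s) - F (Z s) (Y s)))).
  move=> n; apply: measurable_funM; first exact: measurable_cst.
  apply: measurable_funB; last exact: measurable_fun_caratheodory.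
  apply: (measurable_fun_caratheodory (Z := fun s => n.+1%:R^-1 *: e + Z s)) => //.
  move=> j; under eq_fun do rewrite mxE.
  by apply: measurable_funD; [exact: measurable_cst|exact: mZ].
move=> s _; have [dF dFE] := Fg (Y s) (Z s).
have -> : g (Z s) (Y s) 0 i = 'D_e (F^~ (Y s)) (Z s).
  by rewrite deriveE// dFE dotv_delta.
by apply: derive_cvg_harmonic; exact: diff_derivable.
Qed.

(** * Square-integrable random vectors *)

Section square_integrable.
Context (R : realType) dO (Omega : measurableType dO) (P : probability Omega R).
Implicit Types f g : Omega -> R.

Local Notation L1 f := (P.-integrable setT (fun w => (f w)%:E)).
Local Notation Ex f := (Rintegral P setT f).

(** Measurability of [f] is asked separately: integrability of the square only gives that of the
    square. *)
Definition L2 f : Prop := measurable_fun setT f /\ L1 (fun w => f w ^+ 2).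

Lemma L1_cst c : L1 (fun=> c).
Proof. exact: finite_measure_integrable_cst. Qed.

Lemma L1D f g : L1 f -> L1 g -> L1 (fun w => f w + g w).
Proof. exact: integrableD. Qed.

Lemma L1Z c f : L1 f -> L1 (fun w => c * f w).
Proof. exact: integrableZl. Qed.

Lemma L1B f g : L1 f -> L1 g -> L1 (fun w => f w - g w).
Proof. exact: integrableB. Qed.

Lemma L1_sum I (r : seq I) (Q : pred I) (F : I -> Omega -> R) :
  (forall i, L1 (F i)) -> L1 (fun w => \sum_(i <- r | Q i) F i w).
Proof.
move=> LF; elim: r => [|i r IH].
  by under eq_fun do rewrite big_nil; exact: L1_cst.
under eq_fun do rewrite big_cons.
by case: (Q i) => //; exact: L1D.
Qed.

Lemma L1_le f g : measurable_fun setT f -> L1 g ->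
  (forall w, `|f w| <= g w) -> L1 f.
Proof.
move=> mf Lg fg; apply: le_integrable Lg => //; first exact/measurable_EFinP.
by move=> w _ /=; rewrite lee_fin (le_trans (fg w))// ler_norm.
Qed.

Lemma Ex_cst c : Ex (fun=> c) = c.
Proof. by rewrite /Rintegral integral_cst//= probability_setT mule1. Qed.

Lemma ExD f g : L1 f -> L1 g -> Ex (fun w => f w + g w) = Ex f + Ex g.
Proof. by move=> Lf Lg; rewrite -RintegralD. Qed.

Lemma ExB f g : L1 f -> L1 g -> Ex (fun w => f w - g w) = Ex f - Ex g.
Proof. by move=> Lf Lg; rewrite -RintegralB. Qed.

Lemma ExZ c f : L1 f -> Ex (fun w => c * f w) = c * Ex f.
Proof. by move=> Lf; rewrite -RintegralZl. Qed.

Lemma Ex_sum I (r : seq I) (Q : pred I) (F : I -> Omega -> R) :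
  (forall i, L1 (F i)) ->
  Ex (fun w => \sum_(i <- r | Q i) F i w) = \sum_(i <- r | Q i) Ex (F i).
Proof.
move=> LF; elim: r => [|i r IH].
  by under eq_fun do rewrite big_nil; rewrite Ex_cst big_nil.
under eq_fun do rewrite big_cons.
rewrite big_cons; case: (Q i) => //.
by rewrite ExD ?IH//; exact: L1_sum.
Qed.

Lemma Ex_le f g : L1 f -> L1 g -> (forall w, f w <= g w) -> Ex f <= Ex g.
Proof. by move=> Lf Lg fg; apply: le_Rintegral. Qed.

Lemma Ex_ge0 f : (forall w, 0 <= f w) -> 0 <= Ex f.
Proof. by move=> f0; exact: Rintegral_ge0. Qed.

Lemma EFin_Ex f : L1 f -> (\int[P]_w (f w)%:E = (Ex f)%:E)%E.
Proof. by move=> Lf; rewrite /Rintegral fineK//; exact: integrable_fin_num. Qed.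

Lemma L2_cst c : L2 (fun=> c).
Proof. by split; [exact: measurable_cst|exact: L1_cst]. Qed.

Lemma L2M f g : L2 f -> L2 g -> L1 (fun w => f w * g w).
Proof.
move=> [mf f2] [mg g2].
apply: (@L1_le _ (fun w => f w ^+ 2 + g w ^+ 2)); [exact: measurable_funM|exact: L1D|].
by move=> w; rewrite ler_norml; apply/andP; split; nra.
Qed.

Lemma L2D f g : L2 f -> L2 g -> L2 (fun w => f w + g w).
Proof.
move=> Lf Lg; have [mf f2] := Lf; have [mg g2] := Lg.
split; first exact: measurable_funD.
under eq_fun do rewrite sqrrD.
apply: L1D => //; apply: L1D => //.
under eq_fun do rewrite mulr2n.
by apply: L1D; exact: L2M.
Qed.

Lemma L2Z c f : L2 f -> L2 (fun w => c * f w).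
Proof.
move=> [mf f2]; split; first by apply: measurable_funM => //; exact: measurable_cst.
by under eq_fun do rewrite exprMn; exact: L1Z.
Qed.

Definition L2v d (V : Omega -> 'rV[R]_d) : Prop := forall i, L2 (fun w => V w 0 i).

Context (d : nat).
Implicit Types U V : Omega -> 'rV[R]_d.

Lemma L2v_cst c : L2v (fun=> c : 'rV[R]_d).
Proof. by move=> i; exact: L2_cst. Qed.

Lemma L2vD U V : L2v U -> L2v V -> L2v (fun w => U w + V w).
Proof.
by move=> LU LV i; under eq_fun do rewrite mxE; exact: L2D.
Qed.

Lemma L2vZ c U : L2v U -> L2v (fun w => c *: U w).
Proof.
by move=> LU i; under eq_fun do rewrite mxE; exact: L2Z.
Qed.

Lemma L2vB U V : L2v U -> L2v V -> L2v (fun w => U w - V w).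
Proof.
move=> LU LV; apply: L2vD => //.
by under eq_fun do rewrite -scaleN1r; exact: L2vZ.
Qed.

Lemma L2v_sum I (r : seq I) (Q : pred I) (F : I -> Omega -> 'rV[R]_d) :
  (forall i, L2v (F i)) -> L2v (fun w => \sum_(i <- r | Q i) F i w).
Proof.
move=> LF; elim: r => [|i r IH].
  by under eq_fun do rewrite big_nil; exact: L2v_cst.
under eq_fun do rewrite big_cons.
by case: (Q i) => //; exact: L2vD.
Qed.

Lemma L2v_avgK n (F : 'I_n -> Omega -> 'rV[R]_d) :
  (forall i, L2v (F i)) -> L2v (fun w => avgK (fun i => F i w)).
Proof. by move=> LF; apply: L2vZ; exact: L2v_sum. Qed.

Lemma L1_dotv U V : L2v U -> L2v V -> L1 (fun w => dotv (U w) (V w)).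
Proof. by move=> LU LV; apply: L1_sum => i; exact: L2M. Qed.

Lemma L1_sqnorm U : L2v U -> L1 (fun w => sqnorm (U w)).
Proof. by move=> LU; apply: L1_sum => i; exact: (LU i).2. Qed.

(** A Lipschitz map grows at most linearly, so [sqnorm (h (U w))] is dominated by a multiple of
    [sqnorm (U w)] plus a constant. *)
Lemma L2v_lipschitz (h : 'rV[R]_d -> 'rV[R]_d) (L : R) U :
  (forall x y, sqnorm (h x - h y) <= L ^+ 2 * sqnorm (x - y)) ->
  (forall i, measurable_fun setT (fun w => h (U w) 0 i)) ->
  L2v U -> L2v (fun w => h (U w)).
Proof.
move=> hL mh LU i; split => //.
apply: (@L1_le _ (fun w => 2 * (L ^+ 2 * sqnorm (U w - 0)) + 2 * sqnorm (h 0))).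
- exact: measurable_funX.
- apply: L1D; last exact: L1_cst.
  apply: L1Z; apply: L1Z; apply: L1_sqnorm; apply: L2vB => //; exact: L2v_cst.
- move=> w; rewrite ger0_norm ?sqr_ge0//.
  apply: (@le_trans _ _ (sqnorm (h (U w)))).
    rewrite /sqnorm (bigD1 i)//= lerDl; apply: sumr_ge0 => j _; exact: sqr_ge0.
  have := sqnormD_le (h (U w) - h 0) (h 0); rewrite subrK.
  have := hL (U w) 0; lra.
Qed.

(** Cross terms vanish, so the bound is linear in the number of terms, where convexity alone would
    give its square. *)
Lemma Ex_sqnorm_orthogonal_sum (A : finType) (N : A -> Omega -> 'rV[R]_d) (s : R) :
  (forall a, L2v (N a)) ->
  (forall a a', a != a' -> Ex (fun w => dotv (N a w) (N a' w)) = 0) ->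
  (forall a, Ex (fun w => sqnorm (N a w)) <= s) ->
  Ex (fun w => sqnorm (\sum_a N a w)) <= #|A|%:R * s.
Proof.
move=> LN oN sN.
under eq_fun do rewrite sqnormE dotv_suml.
rewrite Ex_sum; last by move=> a; apply: L1_dotv => //; exact: L2v_sum.
rewrite mulr_natl -sumr_const; apply: ler_sum => a _.
under eq_fun do rewrite dotv_sumr.
rewrite Ex_sum; last by move=> a'; exact: L1_dotv.
rewrite (bigD1 a)//= big1 ?addr0.
  by under eq_fun do rewrite -sqnormE.
by move=> a'; rewrite eq_sym; exact: oN.
Qed.

End square_integrable.

(** * Solving the consensus recursion over one round *)

Section window.
Context (R : realType).

Lemma sum_natr n : 2 * \sum_(m < n) m%:R = n%:R * (n%:R - 1) :> R.
Proof.
elim: n => [|n IH]; first by rewrite big_ord0 mulr0 mul0r.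
rewrite big_ord_recr/= mulrDr IH -natr1; ring.
Qed.

(** The left side equals n(n-1)(2n-1)/3, and 2n-1 <= 3(n-1) once n >= 2; for n <= 1 both sides are
    0. This form produces the factor (I-1)^2 of the final bound. *)
Lemma sum_natr_sqr n : 2 * \sum_(m < n) m%:R ^+ 2 <= n%:R * (n%:R - 1) ^+ 2 :> R.
Proof.
case: n => [|n]; first by rewrite big_ord0 mulr0 mul0r.
elim: n => [|n IH]; first by rewrite big_ord_recr big_ord0/= expr0n/= subrr expr0n/=; lra.
rewrite big_ord_recr/= mulrDr.
move: IH; set s := _ * bigop _ _ _; rewrite -!natr1.
have : 0 <= n%:R :> R by []; set x := n%:R; nra.
Qed.

(** Bound every partial sum in the recursion by the full sum [S], then add over [m]: this leaves a
    linear inequality in the single unknown [S]. *)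
Lemma window_sum_le (I : nat) (v : nat -> R) (eta L sigma zeta : R) :
  (0 < I)%N ->
  (forall m, 0 <= v m) ->
  (forall m, (m < I)%N -> v m <= 2 * eta ^+ 2 * m%:R * sigma ^+ 2 +
     4 * eta ^+ 2 * m%:R * (L ^+ 2 * (\sum_(r < m) v r) + m%:R * zeta ^+ 2)) ->
  81 * L ^+ 2 * I%:R ^+ 2 * eta ^+ 2 <= 1 ->
  \sum_(m < I) v m <= I%:R * (3 * eta ^+ 2 * (I%:R - 1) * sigma ^+ 2 +
     5 * eta ^+ 2 * (I%:R - 1) ^+ 2 * zeta ^+ 2).
Proof.
move=> I0 v0 vle small.
set S := \sum_(m < I) v m.
have S0 : 0 <= S by exact: sumr_ge0.
have psum m : (m < I)%N -> \sum_(r < m) v r <= S.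
  move=> mI; rewrite /S (big_ord_widen I v (ltnW mI)).
  rewrite [leRHS](bigID (fun i : 'I_I => (i < m)%N))/= lerDl.
  by apply: sumr_ge0.
have H : S <= \sum_(m < I) (2 * eta ^+ 2 * sigma ^+ 2 * m%:R +
    4 * eta ^+ 2 * L ^+ 2 * S * m%:R + 4 * eta ^+ 2 * zeta ^+ 2 * m%:R ^+ 2).
  apply: ler_sum => m _; apply: (le_trans (vle m (ltn_ord m))).
  have : 4 * eta ^+ 2 * m%:R * L ^+ 2 * (\sum_(r < m) v r) <= 4 * eta ^+ 2 * m%:R * L ^+ 2 * S.
    apply: ler_wpM2l (psum m (ltn_ord m)).
    by rewrite !(sqr_ge0, mulr_ge0).
  lra.
rewrite !big_split/= -!mulr_sumr in H.
have s1 := sum_natr I; have s2 := sum_natr_sqr I.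
move: H s1 s2; set A := \sum_(m < I) m%:R; set B := \sum_(m < I) m%:R ^+ 2.
have I1 : 1 <= I%:R :> R by rewrite ler1n.
move: I1 small; set i := I%:R => i1 small H s1 s2.
(* The term in [S] has weight at most 2/81, so the left-hand side absorbs it. *)
have HA : 4 * eta ^+ 2 * L ^+ 2 * S * A <= 2 / 81 * S.
  have -> : 4 * eta ^+ 2 * L ^+ 2 * S * A = 2 * eta ^+ 2 * L ^+ 2 * S * (2 * A) by ring.
  rewrite s1.
  have : 81 * L ^+ 2 * eta ^+ 2 * (i * (i - 1)) <= 1.
    apply: le_trans small.
    have -> : 81 * L ^+ 2 * i ^+ 2 * eta ^+ 2 = 81 * L ^+ 2 * eta ^+ 2 * (i * i) by ring.
    apply: ler_wpM2l; first by rewrite !(sqr_ge0, mulr_ge0)//.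
    by nra.
  move=> /(ler_wpM2r S0); rewrite mul1r; lra.
have HB : 4 * eta ^+ 2 * zeta ^+ 2 * B <= 2 * eta ^+ 2 * zeta ^+ 2 * (i * (i - 1) ^+ 2).
  have -> : 4 * eta ^+ 2 * zeta ^+ 2 * B = 2 * eta ^+ 2 * zeta ^+ 2 * (2 * B) by ring.
  by apply: ler_wpM2l => //; rewrite !(sqr_ge0, mulr_ge0)//.
have HC : 2 * eta ^+ 2 * sigma ^+ 2 * A = eta ^+ 2 * sigma ^+ 2 * (i * (i - 1)).
  by rewrite -s1; ring.
have p1 : 0 <= eta ^+ 2 * sigma ^+ 2 * (i * (i - 1)).
  by apply: mulr_ge0; [rewrite mulr_ge0 ?sqr_ge0//|nra].
have p2 : 0 <= eta ^+ 2 * zeta ^+ 2 * (i * (i - 1) ^+ 2).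
  by rewrite !(sqr_ge0, mulr_ge0)//; lra.
(* What remains is (79/81) S <= p1 + 2 p2, with p1 and p2 the two quantities just shown nonnegative;
   81/79 <= 3 and 162/79 <= 5 conclude. *)
lra.
Qed.
End window.

(** * Measurability and second moments of random vectors *)

Section measurable_vectors.
Context (R : realType) (d : nat) dE (E : measurableType dE).
Implicit Types U V : E -> 'rV[R]_d.

Definition measurable_vec V := forall i, measurable_fun setT (fun w => V w 0 i).

Lemma measurable_vec_cst c : measurable_vec (fun=> c).
Proof. by move=> i; exact: measurable_cst. Qed.

Lemma measurable_vecD U V : measurable_vec U -> measurable_vec V ->
  measurable_vec (fun w => U w + V w).
Proof. by move=> mU mV i; under eq_fun do rewrite mxE; exact: measurable_funD. Qed.

Lemma measurable_vecZ c U : measurable_vec U -> measurable_vec (fun w => c *: U w).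
Proof.
move=> mU i; under eq_fun do rewrite mxE.
by apply: measurable_funM => //; exact: measurable_cst.
Qed.

Lemma measurable_vecB U V : measurable_vec U -> measurable_vec V ->
  measurable_vec (fun w => U w - V w).
Proof.
move=> mU mV; apply: measurable_vecD => //.
by under eq_fun do rewrite -scaleN1r; exact: measurable_vecZ.
Qed.

Lemma measurable_vec_sum I (r : seq I) (Q : pred I) (F : I -> E -> 'rV[R]_d) :
  (forall i, measurable_vec (F i)) -> measurable_vec (fun w => \sum_(i <- r | Q i) F i w).
Proof.
move=> mF; elim: r => [|i r IH].
  by under eq_fun do rewrite big_nil; exact: measurable_vec_cst.
under eq_fun do rewrite big_cons.
by case: (Q i) => //; exact: measurable_vecD.
Qed.

Lemma measurable_vec_avgK n (F : 'I_n -> E -> 'rV[R]_d) :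
  (forall i, measurable_vec (F i)) -> measurable_vec (fun w => avgK (fun i => F i w)).
Proof. by move=> mF; apply: measurable_vecZ; exact: measurable_vec_sum. Qed.

Lemma measurable_sqnorm V : measurable_vec V -> measurable_fun setT (fun w => sqnorm (V w)).
Proof.
by move=> mV; apply: measurable_sum => i; exact: measurable_funX.
Qed.

Lemma measurable_vec_gradient (h : 'rV[R]_d -> R) gh V : has_gradient h gh ->
  measurable_vec V -> measurable_vec (fun w => gh (V w)).
Proof.
move=> hg mV.
exact: (@measurable_fun_gradient _ _ _ _ _ E V id (fun x _ => h x) (fun x _ => gh x)).
Qed.

End measurable_vectors.

Section second_moment.
Context (R : realType) (d : nat) dO (Omega : measurableType dO) (P : probability Omega R).
Implicit Types V : Omega -> 'rV[R]_d.

(** The bound is on the extended-real integral because it must also exclude the value +oo, which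
    [Rintegral] would send to 0. *)
Lemma L2v_sqnorm V C : measurable_vec V ->
  (\int[P]_w (sqnorm (V w))%:E <= C%:E)%E -> L2v P V.
Proof.
move=> mV VC i; split => //.
apply: (@L1_le _ _ _ P _ (fun w => sqnorm (V w))); first exact: measurable_funX.
  apply/integrableP; split; first by apply/measurable_EFinP; exact: measurable_sqnorm.
  under eq_integral do rewrite gee0_abs ?lee_fin ?sqnorm_ge0//.
  by rewrite (le_lt_trans VC)// ltry.
move=> w; rewrite ger0_norm ?sqr_ge0//.
by rewrite /sqnorm (bigD1 i)//= lerDl; apply: sumr_ge0 => j _; exact: sqr_ge0.
Qed.

Lemma Ex_sqnorm_le V C : measurable_vec V ->
  (\int[P]_w (sqnorm (V w))%:E <= C%:E)%E ->
  Rintegral P setT (fun w => sqnorm (V w)) <= C.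
Proof.
move=> mV VC; have LV := L1_sqnorm (L2v_sqnorm mV VC).
by move: VC; rewrite EFin_Ex// lee_fin.
Qed.

(* Jensen's inequality: the variance of [V] is nonnegative. *)
Lemma sqnorm_expectation_le V (m : 'rV[R]_d) C : measurable_vec V ->
  (forall i, (\int[P]_w (V w 0 i)%:E = (m 0 i)%:E)%E) ->
  (\int[P]_w (sqnorm (V w))%:E <= C%:E)%E -> sqnorm m <= C.
Proof.
move=> mV Vm VC; have LV := L2v_sqnorm mV VC.
apply: le_trans (Ex_sqnorm_le mV VC).
have L1V i : P.-integrable setT (fun w => (V w 0 i)%:E).
  have := L2M (LV i) (L2_cst P 1).
  by under eq_fun do rewrite mulr1.
have Lm := L2v_cst P m.
have dot_m : Rintegral P setT (fun w => dotv (V w) m) = sqnorm m.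
  rewrite Ex_sum; last by move=> i; exact: L2M.
  apply: eq_bigr => i _; under eq_fun do rewrite mulrC.
  by rewrite ExZ// /Rintegral Vm/= expr2.
have : 0 <= Rintegral P setT (fun w => sqnorm (V w - m)).
  by apply: Ex_ge0 => w; exact: sqnorm_ge0.
under eq_fun do rewrite sqnormB.
have LVm := L1_dotv LV Lm.
rewrite ExD; [|by apply: L1B; [exact: L1_sqnorm|exact: L1Z]|exact: L1_cst].
rewrite ExB; [|exact: L1_sqnorm|exact: L1Z].
rewrite ExZ// Ex_cst dot_m; lra.
Qed.

End second_moment.

(** * Noise of a sample independent of the query point *)

Section fresh_sample.
Context d dX (Omega : measurableType d) (X : measurableType dX) (R : realType).
Variables (P : probability Omega R) (D : probability X R).
Variables (G : set (set Omega)) (Y : Omega -> X).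
Hypothesis setIG : setI_closed G.
Hypothesis GT : G setT.
Hypothesis mG : G `<=` measurable.
Hypothesis mY : measurable_fun setT Y.
Hypothesis indepGY : forall A B, G A -> measurable B ->
  P (A `&` Y @^-1` B) = (P A * D B)%E.

Local Notation E := [the measurableType _ of g_sigma_algebraType G].

Variables (n : nat) (F : 'rV[R]_n -> X -> R) (g : 'rV[R]_n -> X -> 'rV[R]_n).
Variables (f : 'rV[R]_n -> R) (gf : 'rV[R]_n -> 'rV[R]_n) (sigma : R).
Hypothesis mF : forall x, measurable_fun setT (F x).
Hypothesis Fg : forall z, has_gradient (F^~ z) (g^~ z).
Hypothesis fgf : has_gradient f gf.
Hypothesis unbiased : forall x i, D.-integrable setT (fun z => (g x z 0 i)%:E) /\
  (\int[D]_z (g x z 0 i)%:E = (gf x 0 i)%:E)%E.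
Hypothesis variance : forall x,
  (\int[D]_z (sqnorm (g x z - gf x))%:E <= (sigma ^+ 2)%:E)%E.

Variable Z : E -> 'rV[R]_n.
Hypothesis mZ : measurable_vec Z.

Let measurable_noise :
  measurable_vec (fun u : E * X => g (Z u.1) u.2 - gf (Z u.1)).
Proof.
have mZ1 : measurable_vec (fun u : E * X => Z u.1).
  by move=> i; exact: (measurableT_comp (mZ i) measurable_fst).
apply: measurable_vecB; last exact: measurable_vec_gradient fgf mZ1.
exact: (measurable_fun_gradient mZ1 measurable_snd mF Fg).
Qed.

(** By independence [w] can be frozen in [Z w] while the sample is integrated against [D]; the
    variance bound at the fixed point [Z w] then applies. *)
Lemma fresh_noise_variance :
  (\int[P]_w (sqnorm (g (Z w) (Y w) - gf (Z w)))%:E <= (sigma ^+ 2)%:E)%E.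
Proof.
pose phi (u : E * X) := (sqnorm (g (Z u.1) u.2 - gf (Z u.1)))%:E.
have mphi : measurable_fun setT phi.
  by apply/measurable_EFinP; exact: measurable_sqnorm.
have phi0 u : (0 <= phi u)%E by rewrite lee_fin sqnorm_ge0.
rewrite -[leLHS]/(\int[P]_w phi (w, Y w))%E.
rewrite (integral_independent_ge0 setIG GT mG mY indepGY mphi phi0).
have -> : (sigma ^+ 2)%:E = (\int[P]_w (cst (sigma ^+ 2)%:E w))%E.
  by rewrite integral_cst//= probability_setT mule1.
apply: ge0_le_integral => //.
- by move=> w _; exact: integral_ge0.
- have := @measurable_fun_fubini_tonelli_F _ _ E X R D phi mphi phi0.
  exact: measurable_fun_g_sigma_algebra_sub.
by move=> w _; have := variance (Z w).
Qed.

(** With [w] frozen, [h w] is a constant factor and the noise has mean zero by unbiasedness at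
    [Z w]. *)
Lemma fresh_noise_orthogonal (h : E -> 'rV[R]_n) : measurable_vec h ->
  L2v P h -> L2v P (fun w => g (Z w) (Y w) - gf (Z w)) ->
  Rintegral P setT (fun w => dotv (h w) (g (Z w) (Y w) - gf (Z w))) = 0.
Proof.
move=> mh Lh Ln; rewrite Ex_sum; last by move=> i; exact: L2M.
apply: big1 => i _.
pose phi (u : E * X) := h u.1 0 i * (g (Z u.1) u.2 - gf (Z u.1)) 0 i.
have mphi : measurable_fun setT phi.
  apply: measurable_funM; last exact: measurable_noise.
  exact: (measurableT_comp (mh i) measurable_fst).
rewrite -[LHS]/(fine (\int[P]_w (phi (w, Y w))%:E)).
rewrite (integral_independent_eq0 setIG GT mG mY indepGY mphi)//.
  exact: L2M.
move=> w; rewrite /phi/=.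
under eq_integral do rewrite !mxE EFinM EFinB.
have [ig igE] := unbiased (Z w) i.
have ic : D.-integrable setT (fun=> (gf (Z w) 0 i)%:E).
  exact: finite_measure_integrable_cst.
rewrite integralZl//; last exact: integrableB.
rewrite integralB// igE integral_cst//= probability_setT mule1.
by rewrite subee// mule0.
Qed.

End fresh_sample.

(** * Samples and iterates *)

Section cylinders.
Context d dX (Omega : measurableType d) (X : measurableType dX) (R : realType).
Context (P : probability Omega R) (A : finType) (D : A -> probability X R).
Variable smp : A -> Omega -> X.
Hypothesis msmp : forall a, measurable_fun setT (smp a).
Hypothesis Psmp : forall B : A -> set X, (forall a, measurable (B a)) ->
  P [set w | forall a, B a (smp a w)] = (\prod_a fine (D a (B a)))%:E.

(** A pi-system generating the sigma-algebra of all samples but [a0]. Leaving out a single sample,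
    rather than everything from its time on, also covers pairs of samples drawn at the same step. *)
Definition cylinder (a0 : A) : set (set Omega) :=
  [set S | exists2 B : A -> set X, (forall a, measurable (B a)) &
    S = [set w | forall a, a != a0 -> B a (smp a w)]].

Lemma setI_closed_cylinder a0 : setI_closed (cylinder a0).
Proof.
move=> _ _ [B mB ->] [C mC ->]; exists (fun a => B a `&` C a).
  by move=> a; exact: measurableI.
apply/seteqP; split => w /=; first by move=> [Bw Cw] a a0a; split; auto.
by move=> H; split => a a0a; have [] := H a a0a.
Qed.

Lemma cylinder_setT a0 : cylinder a0 setT.
Proof. by exists (fun=> setT) => //; apply/seteqP; split. Qed.

Lemma cylinder_measurable a0 : cylinder a0 `<=` measurable.
Proof.
move=> _ [B mB ->].
have -> : [set w | forall a, a != a0 -> B a (smp a w)] =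
    \bigcap_(a in [set a | a != a0]) (smp a @^-1` B a) by [].
apply: fin_bigcap_measurable => [|a _]; first exact: finite_finset.
by rewrite -[X in measurable X]setTI; exact: msmp.
Qed.

(** Putting [B] at coordinate [a0] turns the intersection into a full rectangle, whose probability
    is a product; the case of [setT] at [a0] identifies the other factors as [P S]. *)
Lemma cylinder_indep a0 S B : cylinder a0 S -> measurable B ->
  P (S `&` smp a0 @^-1` B) = (P S * D a0 B)%E.
Proof.
move=> [C mC ->] mB.
pose C' B a := if a == a0 then B else C a.
have mC' B' : measurable B' -> forall a, measurable (C' B' a).
  by move=> mB' a; rewrite /C'; case: ifP.
have PC' B' : measurable B' ->
    P ([set w | forall a, a != a0 -> C a (smp a w)] `&` smp a0 @^-1` B') =
    ((\prod_(a | a != a0) fine (D a (C a)))%:E * D a0 B')%E.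
  move=> mB'; transitivity (P [set w | forall a, C' B' a (smp a w)]).
    congr (P _); apply/seteqP; split => w /=; rewrite /C'.
      by move=> [Cw Bw] a; case: eqVneq => [->//|]; exact: Cw.
    move=> H; split => [a a0a|]; first by have := H a; rewrite (negPf a0a).
    by have := H a0; rewrite eqxx.
  rewrite Psmp; last exact: mC'.
  rewrite (bigD1 a0)//= /C' eqxx mulrC EFinM fineK ?fin_num_measure//.
  by congr (_%:E * _)%E; apply: eq_bigr => a /negPf ->.
rewrite PC'//; congr (_ * _)%E; have := PC' _ (@measurableT _ X).
by rewrite preimage_setT setIT probability_setT mule1 => ->.
Qed.

Lemma cylinder_measurable_sample a0 a : a != a0 ->
  measurable_fun setT (smp a : g_sigma_algebraType (cylinder a0) -> X).
Proof.
move=> aa0 _ B mB; rewrite setTI; apply: sub_sigma_algebra.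
exists (fun a' => if a' == a then B else setT).
  by move=> a'; case: ifP.
apply/seteqP; split => w /=; first by move=> Bw a' _; case: eqVneq => [->|].
by move=> /(_ a aa0); rewrite eqxx.
Qed.

End cylinders.

Section fedavg_measurable.
Context (R : realType) (d : nat) dX (X : measurableType dX) (K b I : nat) (eta : R).
Variables (F : 'I_K -> 'rV[R]_d -> X -> R) (g : 'I_K -> 'rV[R]_d -> X -> 'rV[R]_d).
Hypothesis mF : forall k x, measurable_fun setT (F k x).
Hypothesis Fg : forall k z, has_gradient ((F k)^~ z) ((g k)^~ z).

(** Only samples of times [r < t] enter the iterate [t]. The restricted hypothesis lets the lemma
    apply to a sigma-algebra that omits a sample of time [t] or later. *)
Lemma measurable_fedavg dE (E : measurableType dE) (x1 : 'rV[R]_d)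
    (s : nat -> 'I_K -> 'I_b -> E -> X) t :
  (forall r k j, (r < t)%N -> measurable_fun setT (s r k j)) ->
  forall k, measurable_vec (fun w => fedavg I eta g x1 (fun r k j => s r k j w) t k).
Proof.
elim: t => [|t IH] ms k; first exact: measurable_vec_cst.
have {}IH := IH (fun r k j rt => ms r k j (ltnW rt)).
have mstep l : measurable_vec (fun w =>
    let x := fedavg I eta g x1 (fun r k j => s r k j w) t l in
    x - eta *: (b%:R^-1 *: \sum_(j < b) g l x (s t l j w))).
  apply: measurable_vecB => //; apply: measurable_vecZ; apply: measurable_vecZ.
  apply: measurable_vec_sum => j.
  exact: (measurable_fun_gradient (IH l) (ms t l j (ltnSn t)) (@mF l) (@Fg l)).
rewrite /=; case: (t.+1 %% I == 0)%N; last exact: mstep.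
exact: measurable_vec_avgK.
Qed.

End fedavg_measurable.

(** * Averaged and local dynamics *)

Section fedavg_dynamics.
Context (R : realType) (d : nat) (X : Type) (K b I : nat) (eta : R).
Variables (g : 'I_K -> 'rV[R]_d -> X -> 'rV[R]_d) (x1 : 'rV[R]_d)
  (s : nat -> 'I_K -> 'I_b -> X).
Hypothesis K0 : (0 < K)%N.
Local Notation x := (fedavg I eta g x1 s).
Local Notation xbar t := (avgK (x t)).

Definition minibatch_grad t k := b%:R^-1 *: \sum_(j < b) g k (x t k) (s t k j).
Local Notation dt := minibatch_grad.

(** Replacing all local points by their mean leaves the mean unchanged, so synchronisation is
    invisible here. *)
Lemma fedavg_mean_step t : xbar t.+1 = xbar t - eta *: avgK (dt t).
Proof.
rewrite /=; case: ifP => _; rewrite ?avgK_cst// -avgKZ -avgKB//.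
Qed.

Lemma fedavg_sync s0 k : x (s0 * I)%N k = xbar (s0 * I)%N.
Proof.
case E : (s0 * I)%N => [|t]; first by rewrite /= avgK_cst.
by rewrite /= -E modnMl eqxx avgK_cst.
Qed.

(** None of [s0 * I + 1], ..., [s0 * I + m] is a multiple of [I], so the node moves alone from the
    synchronised point. *)
Lemma fedavg_local s0 m k : (m < I)%N ->
  x (s0 * I + m)%N k = xbar (s0 * I)%N - eta *: \sum_(r < m) dt (s0 * I + r)%N k.
Proof.
elim: m => [|m IH] mI; first by rewrite addn0 big_ord0 scaler0 subr0 fedavg_sync.
rewrite big_ord_recr/= scalerDr opprD addrA -(IH (ltnW mI)) addnS /=.
by rewrite -addnS modnMDl modn_small.
Qed.

End fedavg_dynamics.

(** * Pathwise descent and consensus inequalities *)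

Section fedavg_pathwise.
Context (R : realType) (d : nat) (X : Type) (K b I : nat) (eta : R).
Variables (g : 'I_K -> 'rV[R]_d -> X -> 'rV[R]_d) (x1 : 'rV[R]_d)
  (s : nat -> 'I_K -> 'I_b -> X).
Variables (fk : 'I_K -> 'rV[R]_d -> R) (gradfk : 'I_K -> 'rV[R]_d -> 'rV[R]_d)
  (gradf : 'rV[R]_d -> 'rV[R]_d) (fstar L zeta : R).
Hypothesis K0 : (0 < K)%N.
Hypothesis b0 : (0 < b)%N.
Hypothesis L0 : 0 <= L.
Hypothesis fkg : forall k, has_gradient (fk k) (gradfk k).
Hypothesis fg : has_gradient (fglob fk) gradf.
Hypothesis fstar_le : forall x, fstar <= fglob fk x.
Hypothesis gradfk_lip : forall k x y,
  sqnorm (gradfk k x - gradfk k y) <= L ^+ 2 * sqnorm (x - y).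
Hypothesis gradfk_het : forall k l x, sqnorm (gradfk k x - gradfk l x) <= zeta ^+ 2.

Local Notation x := (fedavg I eta g x1 s).
Local Notation xbar t := (avgK (x t)).
Local Notation dt := (minibatch_grad I eta g x1 s).

Definition grad_noise t k j := g k (x t k) (s t k j) - gradfk k (x t k).
Definition mean_grad t := avgK (fun k => gradfk k (x t k)).
(** A single sum over pairs, so that the orthogonal-sum bound treats all the noises of a step at
    once. *)
Definition mean_noise t :=
  (K%:R^-1 * b%:R^-1) *: \sum_(p : 'I_K * 'I_b) grad_noise t p.1 p.2.
Definition consensus_error t := K%:R^-1 * \sum_(k < K) sqnorm (x t k - xbar t).

Let KR0 : K%:R != 0 :> R. Proof. by rewrite pnatr_eq0 -lt0n. Qed.
Let bR0 : b%:R != 0 :> R. Proof. by rewrite pnatr_eq0 -lt0n. Qed.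

Lemma consensus_error_ge0 t : 0 <= consensus_error t.
Proof. by rewrite mulr_ge0 ?invr_ge0// sumr_ge0// => k _; exact: sqnorm_ge0. Qed.

Lemma avgK_le (F : 'I_K -> R) c : (forall k, F k <= c) -> K%:R^-1 * \sum_(k < K) F k <= c.
Proof.
move=> Fc; apply: (@le_trans _ _ (K%:R^-1 * \sum_(k < K) c)).
  by rewrite ler_wpM2l ?invr_ge0//; exact: ler_sum.
by rewrite sumr_const card_ord -[c *+ K]mulr_natl mulrA mulVf// mul1r.
Qed.

Lemma gradf_lip y z : sqnorm (gradf y - gradf z) <= L ^+ 2 * sqnorm (y - z).
Proof.
rewrite !(gradient_fglob fkg fg) -avgKB.
by apply: le_trans (sqnorm_avgK_le _) _; apply: avgK_le => k.
Qed.

Lemma gradf_het k y : sqnorm (gradfk k y - gradf y) <= zeta ^+ 2.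
Proof.
rewrite (gradient_fglob fkg fg) -{1}(avgK_cst (gradfk k y) K0) -avgKB.
by apply: le_trans (sqnorm_avgK_le _) _; apply: avgK_le => l.
Qed.

Lemma minibatch_gradE t k :
  dt t k = gradfk k (x t k) + b%:R^-1 *: \sum_(j < b) grad_noise t k j.
Proof.
rewrite /grad_noise sumrB scalerBr sumr_const card_ord -[gradfk _ _ *+ b]scaler_nat.
by rewrite scalerA mulVf// scale1r addrCA subrr addr0.
Qed.

Lemma mean_minibatch_gradE t : avgK (dt t) = mean_grad t + mean_noise t.
Proof.
have -> : avgK (dt t) =
    avgK (fun k => gradfk k (x t k) + b%:R^-1 *: \sum_(j < b) grad_noise t k j).
  by congr avgK; apply/funext => k; exact: minibatch_gradE.
rewrite /mean_grad /mean_noise /avgK big_split/= scalerDr; congr (_ + _).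
by rewrite -scaler_sumr scalerA pair_bigA.
Qed.

Lemma sqnorm_gradf_mean_grad_le t :
  sqnorm (gradf (xbar t) - mean_grad t) <= L ^+ 2 * consensus_error t.
Proof.
rewrite (gradient_fglob fkg fg) -avgKB.
apply: le_trans (sqnorm_avgK_le _) _.
rewrite /consensus_error mulrCA ler_wpM2l ?invr_ge0//.
rewrite mulr_sumr; apply: ler_sum => k _.
by rewrite -(sqnormN (x t k - _)) opprB.
Qed.

Lemma descent_telescope n :
  fglob fk (xbar n) <= fglob fk x1 + \sum_(t < n)
    (- eta * dotv (gradf (xbar t)) (avgK (dt t)) + L / 2 * eta ^+ 2 * sqnorm (avgK (dt t))).
Proof.
elim: n => [|n IH]; first by rewrite big_ord0 addr0 /= avgK_cst.
rewrite big_ord_recr/=.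
have := smooth_le (xbar n) (xbar n.+1) L0 fg gradf_lip.
rewrite (fedavg_mean_step I eta g x1 s K0 n) [_ - _ - _]addrAC subrr add0r.
rewrite dotvNr dotvZr sqnormN sqnormZ; lra.
Qed.

(** With G the gradient at the mean, M the mean gradient and N the mean noise, polarisation writes
    -<G, M> as half of |G-M|^2 - |G|^2 - |M|^2. The term |G-M|^2 is a consensus error, the products
    with N gather into one inner product, and |M|^2 ends with coefficient -eta(1 - L eta)/2 <= 0. *)
Lemma descent_pathwise n : 0 <= eta -> L * eta <= 1 ->
  eta / 2 * \sum_(t < n) sqnorm (gradf (xbar t)) <= fglob fk x1 - fstar +
   \sum_(t < n) (eta / 2 * L ^+ 2 * consensus_error t +
     dotv (L * eta ^+ 2 *: mean_grad t - eta *: gradf (xbar t)) (mean_noise t) +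
     L / 2 * eta ^+ 2 * sqnorm (mean_noise t)).
Proof.
move=> eta0 Leta; have := descent_telescope n; have := fstar_le (xbar n).
rewrite mulr_sumr.
suff H : \sum_(t < n)
    (- eta * dotv (gradf (xbar t)) (avgK (dt t)) + L / 2 * eta ^+ 2 * sqnorm (avgK (dt t))) <=
    \sum_(t < n) (eta / 2 * L ^+ 2 * consensus_error t +
     dotv (L * eta ^+ 2 *: mean_grad t - eta *: gradf (xbar t)) (mean_noise t) +
     L / 2 * eta ^+ 2 * sqnorm (mean_noise t)) - \sum_(t < n) eta / 2 * sqnorm (gradf (xbar t)).
  by move: H; lra.
rewrite -sumrB; apply: ler_sum => t _.
rewrite mean_minibatch_gradE.
have := sqnorm_gradf_mean_grad_le t.
set G := gradf _; set M := mean_grad t; set N := mean_noise t; set v := consensus_error t.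
clearbody G M N v.
rewrite sqnormB dotvDr dotvDl dotvNl !dotvZl sqnormD => /(ler_wpM2l eta0) H1.
have H2 : 0 <= eta * (1 - L * eta) * sqnorm M.
  by rewrite !mulr_ge0 ?sqnorm_ge0// subr_ge0.
lra.
Qed.

Lemma consensus_window s0 m : (m < I)%N ->
  consensus_error (s0 * I + m)%N <=
  2 * eta ^+ 2 * b%:R^-1 ^+ 2 * (K%:R^-1 * \sum_(k < K)
     sqnorm (\sum_(p : 'I_m * 'I_b) grad_noise (s0 * I + p.1)%N k p.2)) +
  4 * eta ^+ 2 * m%:R *
    (L ^+ 2 * (\sum_(r < m) consensus_error (s0 * I + r)%N) + m%:R * zeta ^+ 2).
Proof.
move=> mI.
(* A reference common to all nodes: full gradient steps from the synchronised point. The mean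
   minimises the sum of squared distances, so measuring from [c] can only increase it. *)
pose c := xbar (s0 * I)%N - eta *: \sum_(r < m) gradf (xbar (s0 * I + r)%N).
apply: (@le_trans _ _ (K%:R^-1 * \sum_(k < K) sqnorm (x (s0 * I + m)%N k - c))).
  by rewrite ler_wpM2l ?invr_ge0//; exact: sum_sqnormB_avgK_le.
pose S k := \sum_(p : 'I_m * 'I_b) grad_noise (s0 * I + p.1)%N k p.2.
pose u k r := gradfk k (x (s0 * I + r)%N k) - gradf (xbar (s0 * I + r)%N).
have xc k : x (s0 * I + m)%N k - c = - (eta *: (b%:R^-1 *: S k + \sum_(r < m) u k r)).
  rewrite (fedavg_local eta g x1 s K0 s0 k mI) /c opprB addrC addrA subrK.
  rewrite -opprB -scalerBr -sumrB; congr (- (eta *: _)).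
  rewrite /S -(pair_bigA _ (fun (r : 'I_m) (j : 'I_b) => grad_noise (s0 * I + r)%N k j))/=.
  rewrite scaler_sumr -big_split/=; apply: eq_bigr => r _.
  by rewrite minibatch_gradE /u addrAC addrC addrA.
have uL k r : sqnorm (u k r) <= 2 * (L ^+ 2 *
    sqnorm (x (s0 * I + r)%N k - xbar (s0 * I + r)%N)) + 2 * zeta ^+ 2.
  have -> : u k r = (gradfk k (x (s0 * I + r)%N k) - gradfk k (xbar (s0 * I + r)%N)) +
      (gradfk k (xbar (s0 * I + r)%N) - gradf (xbar (s0 * I + r)%N)) by rewrite addrA subrK.
  apply: (le_trans (sqnormD_le _ _)); apply: lerD; rewrite ler_pM2l//.
  exact: gradf_het.
(* The noise stays inside one square, as its orthogonality shows only in expectation; the sum of the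
   [u k r] pays a factor [m] by convexity. Two successive splittings give the constant 4. *)
have Hk k : sqnorm (x (s0 * I + m)%N k - c) <= 2 * eta ^+ 2 * b%:R^-1 ^+ 2 * sqnorm (S k) +
    4 * eta ^+ 2 * m%:R * (L ^+ 2 * (\sum_(r < m)
      sqnorm (x (s0 * I + r)%N k - xbar (s0 * I + r)%N)) + m%:R * zeta ^+ 2).
  rewrite xc sqnormN sqnormZ.
  have H1 := sqnormD_le (b%:R^-1 *: S k) (\sum_(r < m) u k r).
  have H2 := sqnorm_sum_le (fun r : 'I_m => u k r).
  have H3 : \sum_(r < m) sqnorm (u k r) <= 2 * L ^+ 2 * (\sum_(r < m)
      sqnorm (x (s0 * I + r)%N k - xbar (s0 * I + r)%N)) + 2 * m%:R * zeta ^+ 2.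
    have -> : 2 * m%:R * zeta ^+ 2 = \sum_(r < m) 2 * zeta ^+ 2.
      by rewrite sumr_const card_ord -[_ *+ m]mulr_natl; ring.
    rewrite mulr_sumr -big_split/=.
    by apply: ler_sum => r _; rewrite -mulrA; exact: uL.
  have H4 := ler_wpM2l (ler0n R m) H3.
  rewrite sqnormZ in H1.
  have H5 : 0 <= eta ^+ 2 by exact: sqr_ge0.
  have /(ler_wpM2l H5) := le_trans H1 (lerD (lexx _) (ler_wpM2l (ler0n R 2) (le_trans H2 H4))).
  by move=> /le_trans; apply; rewrite le_eqVlt; apply/orP; left; apply/eqP; ring.
apply: (@le_trans _ _ (K%:R^-1 * \sum_(k < K) (2 * eta ^+ 2 * b%:R^-1 ^+ 2 * sqnorm (S k) +
    4 * eta ^+ 2 * m%:R * (L ^+ 2 * (\sum_(r < m)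
      sqnorm (x (s0 * I + r)%N k - xbar (s0 * I + r)%N)) + m%:R * zeta ^+ 2)))).
  by rewrite ler_wpM2l ?invr_ge0//; exact: ler_sum.
have -> : \sum_(r < m) consensus_error (s0 * I + r)%N = K%:R^-1 *
    \sum_(k < K) \sum_(r < m) sqnorm (x (s0 * I + r)%N k - xbar (s0 * I + r)%N).
  by rewrite [in RHS]exchange_big/= mulr_sumr.
rewrite big_split/= -!mulr_sumr big_split/= -mulr_sumr sumr_const card_ord.
rewrite -[_ *+ K]mulr_natl.
rewrite le_eqVlt; apply/orP; left; apply/eqP; field.
by rewrite KR0 bR0.
Qed.

End fedavg_pathwise.

(** * Expected gradient norm along the iterates *)

Section fedavg_expectation.
Context (R : realType) (d : nat) (dX : measure_display) (X : measurableType dX).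
Context (K : nat) (D : 'I_K -> probability X R).
Variables (F : 'I_K -> 'rV[R]_d -> X -> R) (g : 'I_K -> 'rV[R]_d -> X -> 'rV[R]_d).
Variables (fk : 'I_K -> 'rV[R]_d -> R) (gradfk : 'I_K -> 'rV[R]_d -> 'rV[R]_d)
  (gradf : 'rV[R]_d -> 'rV[R]_d) (fstar L sigma zeta : R).
Context (dO : measure_display) (Omega : measurableType dO) (P : probability Omega R).
Variables (b I T : nat) (xi : nat -> 'I_K -> 'I_b -> Omega -> X) (x1 : 'rV[R]_d) (eta : R).
Hypothesis K0 : (0 < K)%N.
Hypothesis b0 : (0 < b)%N.
Hypothesis I0 : (0 < I)%N.
Hypothesis IT : (I %| T)%N.
Hypothesis L0 : 0 <= L.
Hypothesis mF : forall k x, measurable_fun setT (F k x).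
Hypothesis Fg : forall k z, has_gradient (fun x => F k x z) (fun x => g k x z).
Hypothesis fkg : forall k, has_gradient (fk k) (gradfk k).
Hypothesis fg : has_gradient (fglob fk) gradf.
Hypothesis fstar_le : forall x, fstar <= fglob fk x.
Hypothesis smooth : forall k x y,
  (\int[D k]_z (sqnorm (g k x z - g k y z))%:E <= (L ^+ 2 * sqnorm (x - y))%:E)%E.
Hypothesis unbiased : forall k x (i : 'I_d), measurable_fun setT (fun z => g k x z 0 i) /\
  (D k).-integrable setT (fun z => (g k x z 0 i)%:E) /\
  (\int[D k]_z (g k x z 0 i)%:E = (gradfk k x 0 i)%:E)%E.
Hypothesis variance : forall k x,
  (\int[D k]_z (sqnorm (g k x z - gradfk k x))%:E <= (sigma ^+ 2)%:E)%E.
Hypothesis het : forall k l x, sqnorm (gradfk k x - gradfk l x) <= zeta ^+ 2.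
Hypothesis mxi : forall t k j, measurable_fun setT (xi t k j).
Hypothesis Pxi : forall A : 'I_T -> 'I_K -> 'I_b -> set X,
  (forall t k j, measurable (A t k j)) ->
  P [set w | forall (t : 'I_T) (k : 'I_K) (j : 'I_b), A t k j (xi t k j w)] =
  (\prod_(t < T) \prod_(k < K) \prod_(j < b) fine (D k (A t k j)))%:E.
Hypothesis eta0 : 0 <= eta.
Hypothesis small : 81 * L ^+ 2 * I%:R ^+ 2 * eta ^+ 2 <= 1.

Local Notation Ex f := (Rintegral P setT f).

(** Jensen's inequality for the difference of stochastic gradients, whose mean is the difference of
    the gradients. *)
Lemma gradfk_lip k x y : sqnorm (gradfk k x - gradfk k y) <= L ^+ 2 * sqnorm (x - y).
Proof.
have gx z := (unbiased k x z).1; have gy z := (unbiased k y z).1.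
apply: (@sqnorm_expectation_le _ _ _ _ (D k) (fun z => g k x z - g k y z)).
- exact: measurable_vecB.
- move=> i; under eq_integral do rewrite !mxE EFinB.
  have [_ [ix ixE]] := unbiased k x i; have [_ [iy iyE]] := unbiased k y i.
  by rewrite integralB// ixE iyE !mxE.
- exact: smooth.
Qed.

Let A : finType := ('I_T * ('I_K * 'I_b))%type.
Let smp (a : A) : Omega -> X := xi a.1 a.2.1 a.2.2.

Let msmp a : measurable_fun setT (smp a).
Proof. exact: mxi. Qed.

Let Psmp (B : A -> set X) : (forall a, measurable (B a)) ->
  P [set w | forall a, B a (smp a w)] = (\prod_a fine (D a.2.1 (B a)))%:E.
Proof.
move=> mB; have := Pxi (fun t k j => mB (t, (k, j))).
have -> : \prod_a fine (D a.2.1 (B a)) =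
    \prod_(t < T) \prod_(k < K) \prod_(j < b) fine (D k (B (t, (k, j)))).
  rewrite /A; under [RHS]eq_bigr do rewrite pair_bigA.
  by rewrite pair_bigA; apply: eq_bigr => -[t [k j]].
move=> <-; congr (P _); apply/seteqP; split => w H.
  by move=> t k j; exact: (H (t, (k, j))).
by move=> [t [k j]]; exact: H.
Qed.

Let x (t : nat) (k : 'I_K) (w : Omega) :=
  fedavg I eta g x1 (fun t k j => xi t k j w) t k.
Let noise (t : nat) (k : 'I_K) (j : 'I_b) (w : Omega) :=
  grad_noise I eta g x1 (fun t k j => xi t k j w) gradfk t k j.

Local Notation E a := (g_sigma_algebraType (cylinder smp a)).

Let measurable_x (a : A) t k : (t <= a.1)%N -> measurable_vec (x t k : E a -> 'rV[R]_d).
Proof.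
move=> ta.
apply: (@measurable_fedavg _ _ _ _ _ _ _ _ F g mF Fg _ (E a) x1 xi t).
move=> r l j rt.
have rT : (r < T)%N by rewrite (leq_trans rt)// (leq_trans ta)// ltnW.
apply: (@cylinder_measurable_sample _ _ _ _ _ smp a (Ordinal rT, (l, j))).
(* A sample of time [r < t <= a.1] cannot be the omitted sample [a]. *)
by apply: contraTneq (leq_trans rt ta) => <-; rewrite ltnn.
Qed.

Let measurable_x_Omega t k : measurable_vec (x t k).
Proof. by apply: (@measurable_fedavg _ _ _ _ _ _ _ _ F g mF Fg _ Omega x1 xi t). Qed.

Let measurable_noise (a a' : A) : (a.1 <= a'.1)%N -> a != a' ->
  measurable_vec (noise a.1 a.2.1 a.2.2 : E a' -> 'rV[R]_d).
Proof.
move=> aa' neq.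
have mx := measurable_x a.2.1 aa'.
apply: measurable_vecB; last exact: measurable_vec_gradient (fkg _) mx.
exact: (measurable_fun_gradient mx (cylinder_measurable_sample neq) (@mF _) (@Fg _)).
Qed.

Let measurable_noise_Omega t k j : measurable_vec (noise t k j).
Proof.
apply: measurable_vecB; last exact: measurable_vec_gradient (fkg _) (measurable_x_Omega t k).
exact: (measurable_fun_gradient (measurable_x_Omega t k) (mxi t k j) (@mF _) (@Fg _)).
Qed.

Let int_noise t k j : (t < T)%N ->
  (\int[P]_w (sqnorm (noise t k j w))%:E <= (sigma ^+ 2)%:E)%E.
Proof.
move=> tT; pose a : A := (Ordinal tT, (k, j)).
have mx := @measurable_x a t k (leqnn _).
exact: (fresh_noise_variance (@setI_closed_cylinder _ _ _ _ _ smp a) (cylinder_setT smp a)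
  (cylinder_measurable msmp (a0 := a)) (mxi t k j) (cylinder_indep Psmp (a0 := a))
  (@mF k) (@Fg k) (fkg k) (@variance k) mx).
Qed.

Let L2_noise t k j : (t < T)%N -> L2v P (noise t k j).
Proof. by move=> tT; exact: L2v_sqnorm (measurable_noise_Omega _ _ _) (int_noise _ _ tT). Qed.

Let Ex_noise t k j : (t < T)%N -> Ex (fun w => sqnorm (noise t k j w)) <= sigma ^+ 2.
Proof. by move=> tT; exact: Ex_sqnorm_le (measurable_noise_Omega _ _ _) (int_noise _ _ tT). Qed.

Let noise_orthogonal (a : A) (h : E a -> 'rV[R]_d) : measurable_vec h -> L2v P h ->
  Ex (fun w => dotv (h w) (noise a.1 a.2.1 a.2.2 w)) = 0.
Proof.
move=> mh Lh; have mx := @measurable_x a a.1 a.2.1 (leqnn _).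
apply: (fresh_noise_orthogonal (@setI_closed_cylinder _ _ _ _ _ smp a) (cylinder_setT smp a)
  (cylinder_measurable msmp (a0 := a)) (msmp a) (cylinder_indep Psmp (a0 := a))
  (@mF a.2.1) (@Fg a.2.1) (fkg a.2.1) _ mx mh Lh); last exact: L2_noise.
by move=> y i; have [_ [? ?]] := unbiased a.2.1 y i.
Qed.

Let noise_pairwise (a a' : A) : a != a' ->
  Ex (fun w => dotv (noise a.1 a.2.1 a.2.2 w) (noise a'.1 a'.2.1 a'.2.2 w)) = 0.
Proof.
(* The later noise plays the fresh one; the other is then a function of samples different from [a'],
   even when the times are equal. *)
wlog aa' : a a' / (a.1 <= a'.1)%N.
  move=> H neq; have [|/ltnW] := leqP a.1 a'.1; first by move=> ?; exact: H.
  move=> ?; under eq_fun do rewrite dotvC.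
  by apply: H => //; rewrite eq_sym.
move=> neq; apply: noise_orthogonal; first exact: measurable_noise.
exact: L2_noise.
Qed.

Local Notation smpl w := (fun t k j => xi t k j w).

Let measurable_gradfk dE (V : measurableType dE) (Z : V -> 'rV[R]_d) k :
  measurable_vec Z -> measurable_vec (fun w => gradfk k (Z w)).
Proof. exact: measurable_vec_gradient (fkg k). Qed.

Let L2_gradfk k Z : measurable_vec Z -> L2v P Z -> L2v P (fun w => gradfk k (Z w)).
Proof.
by move=> mZ; apply: (L2v_lipschitz (gradfk_lip k)); exact: measurable_gradfk.
Qed.

(** By induction: a minibatch gradient is a Lipschitz function of the current iterate plus
    square-integrable noise. *)
Let L2_x t k : (t <= T)%N -> L2v P (x t k).
Proof.
elim: t k => [|t IH] k tT; first exact: L2v_cst.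
have {}IH l := IH l (ltnW tT).
have Lstep l : L2v P (fun w =>
    x t l w - eta *: minibatch_grad I eta g x1 (smpl w) t l).
  apply: L2vB => //; apply: L2vZ.
  under eq_fun do rewrite (minibatch_gradE I eta g x1 _ gradfk b0).
  apply: L2vD; first exact (@L2_gradfk l (x t l) (measurable_x_Omega t l) (IH l)).
  by apply: L2vZ; apply: L2v_sum => j; exact: L2_noise.
rewrite /x /=; case: (t.+1 %% I == 0)%N; last exact: Lstep.
exact: L2v_avgK.
Qed.

Let xbar t w := avgK (fun k => x t k w).

Let L2_xbar t : (t <= T)%N -> L2v P (xbar t).
Proof. by move=> tT; apply: L2v_avgK => k; exact: L2_x. Qed.

Let measurable_xbar t : measurable_vec (xbar t).
Proof. by apply: measurable_vec_avgK => k; exact: measurable_x_Omega. Qed.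

Let L2_gradf_mean t : (t <= T)%N -> L2v P (fun w => gradf (xbar t w)).
Proof.
move=> tT; apply: (L2v_lipschitz (gradf_lip K0 fkg fg gradfk_lip)); last exact: L2_xbar.
exact: measurable_vec_gradient fg (measurable_xbar t).
Qed.

Let M t w := mean_grad I eta g x1 (smpl w) gradfk t.
Let N t w := mean_noise I eta g x1 (smpl w) gradfk t.
Let v t w := consensus_error I eta g x1 (smpl w) t.

Let L2_M t : (t <= T)%N -> L2v P (M t).
Proof.
move=> tT; apply: L2v_avgK => k.
exact (@L2_gradfk k (x t k) (measurable_x_Omega t k) (L2_x k tT)).
Qed.

Let L2_N t : (t < T)%N -> L2v P (N t).
Proof. by move=> tT; apply: L2vZ; apply: L2v_sum => p; exact: L2_noise. Qed.

Let L1_v t : (t <= T)%N -> P.-integrable setT (fun w => (v t w)%:E).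
Proof.
move=> tT; apply: L1Z; apply: L1_sum => k; apply: L1_sqnorm.
by apply: L2vB; [exact: L2_x|exact: L2_xbar].
Qed.

Let Ex_N t : (t < T)%N -> Ex (fun w => sqnorm (N t w)) <= sigma ^+ 2 / (b * K)%:R.
Proof.
move=> tT; under eq_fun do rewrite /N /mean_noise sqnormZ.
rewrite ExZ; last by apply: L1_sqnorm; apply: L2v_sum => p; exact: L2_noise.
have := @Ex_sqnorm_orthogonal_sum _ _ _ P _ ('I_K * 'I_b)%type
  (fun p => noise t p.1 p.2) (sigma ^+ 2) (fun p => @L2_noise t p.1 p.2 tT).
move=> /(_ _ (fun p => @Ex_noise t p.1 p.2 tT)) H.
have KR : K%:R != 0 :> R by rewrite pnatr_eq0 -lt0n.
have bR : b%:R != 0 :> R by rewrite pnatr_eq0 -lt0n.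
have {}H : Ex (fun w => sqnorm (\sum_p noise t p.1 p.2 w)) <=
    #|{: 'I_K * 'I_b}|%:R * sigma ^+ 2.
  apply: H => p q pq; apply: (@noise_pairwise (Ordinal tT, p) (Ordinal tT, q)).
  by apply: contra_neq pq => -[].
apply: (le_trans (ler_wpM2l (sqr_ge0 _) H)).
rewrite card_prod !card_ord !natrM le_eqVlt; apply/orP; left; apply/eqP; field.
by rewrite KR bR.
Qed.

Let Ex_dot_N t : (t < T)%N ->
  Ex (fun w => dotv (L * eta ^+ 2 *: M t w - eta *: gradf (xbar t w)) (N t w)) = 0.
Proof.
move=> tT; pose h w := L * eta ^+ 2 *: M t w - eta *: gradf (xbar t w).
rewrite -[LHS]/(Ex (fun w => dotv (h w) (N t w))).
have Lh : L2v P h.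
  by apply: L2vB; apply: L2vZ; [apply: L2_M|apply: L2_gradf_mean]; exact: ltnW.
under eq_fun do rewrite /N /mean_noise dotvZr dotv_sumr.
have L1p (p : 'I_K * 'I_b) : P.-integrable setT (fun w => (dotv (h w) (noise t p.1 p.2 w))%:E).
  by apply: L1_dotv => //; exact: L2_noise.
rewrite ExZ; last exact: L1_sum.
rewrite Ex_sum// big1 ?mulr0// => p _.
(* [h] depends only on the iterates of time [t], hence on samples drawn before any noise of step
   [t]. *)
apply: (@noise_orthogonal (Ordinal tT, p)) => //.
have mx k : measurable_vec (x t k : E ((Ordinal tT, p) : A) -> 'rV[R]_d).
  by apply: measurable_x.
apply: measurable_vecB; apply: measurable_vecZ.
  by apply: measurable_vec_avgK => k; exact (@measurable_gradfk _
    [the measurableType _ of E ((Ordinal tT, p) : A)] (x t k) k (mx k)).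
by apply: (measurable_vec_gradient fg); exact: measurable_vec_avgK.
Qed.

Let Ex_v_window s0 m : (m < I)%N -> (s0 * I + m < T)%N ->
  Ex (v (s0 * I + m)) <= 2 * eta ^+ 2 * m%:R * sigma ^+ 2 +
    4 * eta ^+ 2 * m%:R *
      (L ^+ 2 * (\sum_(r < m) Ex (v (s0 * I + r))) + m%:R * zeta ^+ 2).
Proof.
move=> mI mT.
have rT (r : 'I_m) : (s0 * I + r < T)%N.
  by apply: leq_trans mT; rewrite ltnS leq_add2l ltnW.
pose S k w := \sum_(p : 'I_m * 'I_b) noise (s0 * I + p.1)%N k p.2 w.
have LS k : L2v P (S k) by apply: L2v_sum => p; exact: L2_noise.
have LSS : P.-integrable setT (fun w => (K%:R^-1 * \sum_(k < K) sqnorm (S k w))%:E).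
  by apply: L1Z; apply: L1_sum => k; exact: L1_sqnorm.
have Lv (r : 'I_m) : P.-integrable setT (fun w => (v (s0 * I + r) w)%:E).
  by apply: L1_v; exact: ltnW.
have Lvs : P.-integrable setT
    (fun w => (L ^+ 2 * (\sum_(r < m) v (s0 * I + r) w) + m%:R * zeta ^+ 2)%:E).
  by apply: L1D (L1_cst _ _); apply: L1Z; exact: L1_sum.
(* Each node has accumulated [m * b] pairwise orthogonal noises since the last synchronisation. *)
have SS : Ex (fun w => K%:R^-1 * \sum_(k < K) sqnorm (S k w)) <= (m * b)%:R * sigma ^+ 2.
  rewrite ExZ; last by apply: L1_sum => k; exact: L1_sqnorm.
  rewrite Ex_sum; last by move=> k; exact: L1_sqnorm.
  apply: avgK_le => // k.
  have := @Ex_sqnorm_orthogonal_sum _ _ _ P _ ('I_m * 'I_b)%type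
    (fun p => noise (s0 * I + p.1)%N k p.2) (sigma ^+ 2).
  rewrite card_prod !card_ord; apply.
  - by move=> p; exact: L2_noise.
  - move=> p q pq.
    apply: (@noise_pairwise (Ordinal (rT p.1), (k, p.2)) (Ordinal (rT q.1), (k, q.2))).
    apply: contra_neq pq; case: p q => [p1 p2] [q1 q2] /= [].
    by move=> /addnI /val_inj -> ->.
  - by move=> p; exact: Ex_noise.
apply: (@le_trans _ _ (Ex (fun w =>
    2 * eta ^+ 2 * b%:R^-1 ^+ 2 * (K%:R^-1 * \sum_(k < K) sqnorm (S k w)) +
    4 * eta ^+ 2 * m%:R *
      (L ^+ 2 * (\sum_(r < m) v (s0 * I + r) w) + m%:R * zeta ^+ 2)))).
  apply: Ex_le.
  - by apply: L1_v; exact: ltnW.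
  - by apply: L1D; exact: L1Z.
  - by move=> w; exact: (consensus_window eta g x1 (smpl w) K0 b0 fkg fg gradfk_lip het).
rewrite ExD; [|exact: L1Z|exact: L1Z].
rewrite ExZ// [X in _ + X <= _]ExZ//.
rewrite ExD; [|by apply: L1Z; exact: L1_sum|exact: L1_cst].
rewrite ExZ; last exact: L1_sum.
rewrite Ex_sum// Ex_cst lerD2r.
have c0 : 0 <= 2 * eta ^+ 2 * b%:R^-1 ^+ 2 by rewrite !(sqr_ge0, mulr_ge0).
apply: (le_trans (ler_wpM2l c0 SS)).
have bR : b%:R != 0 :> R by rewrite pnatr_eq0 -lt0n.
have -> : 2 * eta ^+ 2 * b%:R^-1 ^+ 2 * ((m * b)%:R * sigma ^+ 2) =
    2 * eta ^+ 2 * m%:R * sigma ^+ 2 * b%:R^-1 by rewrite natrM; field.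
(* The gain 1/b from minibatching is given up here. *)
rewrite ler_piMr ?invf_le1 ?ltr0n ?ler1n//.
by rewrite !(sqr_ge0, mulr_ge0).
Qed.

Let Ex_v_sum : \sum_(t < T) Ex (v t) <=
  T%:R * (3 * eta ^+ 2 * (I%:R - 1) * sigma ^+ 2 + 5 * eta ^+ 2 * (I%:R - 1) ^+ 2 * zeta ^+ 2).
Proof.
set B := (X in _ * X).
(* As [I] divides [T], whole rounds fill the horizon: take [q = T %/ I]. *)
suff H q : (q * I <= T)%N -> \sum_(t < q * I) Ex (v t) <= (q * I)%:R * B.
  by have := H (T %/ I)%N; rewrite divnK//; apply.
elim: q => [|q IH] qT; first by rewrite mul0n big_ord0 mul0r.
have qT' : (q * I <= T)%N by apply: leq_trans qT; rewrite leq_mul.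
rewrite mulSn addnC big_split_ord natrD mulrDl; apply: lerD; first exact: IH.
apply: (@window_sum_le _ I (fun m => Ex (v (q * I + m)))) => //.
  by move=> m; apply: Ex_ge0 => w; exact: consensus_error_ge0.
  move=> m mI; apply: Ex_v_window => //.
  by rewrite (leq_trans _ qT)// mulSn addnC ltn_add2r.
exact: small.
Qed.

Let gradient_sum_le : L * eta <= 1 ->
  eta / 2 * \sum_(t < T) Ex (fun w => sqnorm (gradf (xbar t w))) <=
  fglob fk x1 - fstar + eta / 2 * L ^+ 2 * (T%:R * (3 * eta ^+ 2 * (I%:R - 1) * sigma ^+ 2 +
    5 * eta ^+ 2 * (I%:R - 1) ^+ 2 * zeta ^+ 2)) +
  T%:R * (L / 2 * eta ^+ 2 * (sigma ^+ 2 / (b * K)%:R)).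
Proof.
move=> Leta.
have tT (t : 'I_T) := ltnW (ltn_ord t).
pose h t w := L * eta ^+ 2 *: M t w - eta *: gradf (xbar t w).
have LG (t : 'I_T) : P.-integrable setT (fun w => (sqnorm (gradf (xbar t w)))%:E).
  by apply: L1_sqnorm; exact: L2_gradf_mean.
have Lh (t : 'I_T) : P.-integrable setT (fun w => (dotv (h t w) (N t w))%:E).
  apply: L1_dotv; last exact: L2_N.
  by apply: L2vB; apply: L2vZ; [apply: L2_M|apply: L2_gradf_mean].
have LN (t : 'I_T) : P.-integrable setT (fun w => (sqnorm (N t w))%:E).
  by apply: L1_sqnorm; exact: L2_N.
have Lv (t : 'I_T) : P.-integrable setT (fun w => (v t w)%:E) by exact: L1_v.
have Lsum (t : 'I_T) : P.-integrable setT (fun w => (eta / 2 * L ^+ 2 * v t w +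
    dotv (h t w) (N t w) + L / 2 * eta ^+ 2 * sqnorm (N t w))%:E).
  by apply: L1D; [apply: L1D => //; exact: L1Z|exact: L1Z].
rewrite -Ex_sum// -ExZ; last exact: L1_sum.
apply: (@le_trans _ _ (Ex (fun w => (fglob fk x1 - fstar) + \sum_(t < T)
    (eta / 2 * L ^+ 2 * v t w + dotv (h t w) (N t w) + L / 2 * eta ^+ 2 * sqnorm (N t w))))).
  apply: Ex_le; first by apply: L1Z; exact: L1_sum.
    by apply: L1D; [exact: L1_cst|exact: L1_sum].
  move=> w.
  exact (descent_pathwise I g x1 (smpl w) K0 b0 L0 fkg fg fstar_le gradfk_lip T eta0 Leta).
rewrite ExD; [|exact: L1_cst|exact: L1_sum].
rewrite Ex_cst Ex_sum// -[leRHS]addrA lerD2l.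
have Et (t : 'I_T) : Ex (fun w => eta / 2 * L ^+ 2 * v t w + dotv (h t w) (N t w) +
    L / 2 * eta ^+ 2 * sqnorm (N t w)) <=
    eta / 2 * L ^+ 2 * Ex (v t) + L / 2 * eta ^+ 2 * (sigma ^+ 2 / (b * K)%:R).
  rewrite ExD; [|by apply: L1D => //; exact: L1Z|exact: L1Z].
  rewrite ExD//; last exact: L1Z.
  rewrite Ex_dot_N// addr0 ExZ// [X in _ + X <= _]ExZ// lerD2l ler_wpM2l ?Ex_N//.
  by rewrite !(sqr_ge0, mulr_ge0)// invr_ge0.
apply: (le_trans (ler_sum _ (fun t _ => Et t))).
rewrite big_split/= -mulr_sumr sumr_const card_ord -[_ *+ T]mulr_natl lerD2r.
apply: ler_wpM2l Ex_v_sum.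
by rewrite !(sqr_ge0, mulr_ge0)// invr_ge0.
Qed.

Lemma L1_sqnorm_gradf_mean t : (t < T)%N -> P.-integrable setT
  (fun w => (sqnorm (gradf (avgK (fedavg I eta g x1 (smpl w) t))))%:E).
Proof. by move=> /ltnW tT; exact: (L1_sqnorm (L2_gradf_mean tT)). Qed.

Lemma Ex_gradient_sum_le : L * eta <= 1 ->
  eta / 2 * \sum_(t < T)
    Ex (fun w => sqnorm (gradf (avgK (fedavg I eta g x1 (smpl w) t)))) <=
  fglob fk x1 - fstar + eta / 2 * L ^+ 2 * (T%:R * (3 * eta ^+ 2 * (I%:R - 1) * sigma ^+ 2 +
    5 * eta ^+ 2 * (I%:R - 1) ^+ 2 * zeta ^+ 2)) +
  T%:R * (L / 2 * eta ^+ 2 * (sigma ^+ 2 / (b * K)%:R)).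
Proof. exact gradient_sum_le. Qed.

End fedavg_expectation.

(** Write p and q for the square roots of [n] and [T], so that eta = p/q. Multiplying by 2/(pq)
    turns the factor eta/2 into 1/q^2, that is 1/T, and the rest is a field identity up to slack. *)
Lemma stepsize_bound (R : realType) (n T : nat) (A B C L s z v : R) :
  (0 < n)%N -> (0 < T)%N -> 0 <= L ->
  let eta := Num.sqrt (n%:R / T%:R) : R in
  eta / 2 * v <= A + eta / 2 * L ^+ 2 *
    (T%:R * (3 * eta ^+ 2 * B * s + 5 * eta ^+ 2 * C * z)) +
    T%:R * (L / 2 * eta ^+ 2 * (s / n%:R)) -> 0 <= s ->
  T%:R^-1 * v <= 2 * A / (Num.sqrt n%:R * Num.sqrt T%:R)
    + 2 * L * s / (Num.sqrt n%:R * Num.sqrt T%:R)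
    + 3 * L ^+ 2 * n%:R * B / T%:R * s + 5 * L ^+ 2 * n%:R * C / T%:R * z.
Proof.
move=> n0 T0 L0 eta H s0.
have etaE : eta = Num.sqrt n%:R / Num.sqrt T%:R by rewrite /eta sqrtrM// sqrtrV.
have nE : n%:R = Num.sqrt n%:R ^+ 2 :> R by rewrite sqr_sqrtr.
have TE : T%:R = Num.sqrt T%:R ^+ 2 :> R by rewrite sqr_sqrtr.
have p0 : 0 < Num.sqrt n%:R :> R by rewrite sqrtr_gt0 ltr0n.
have q0 : 0 < Num.sqrt T%:R :> R by rewrite sqrtr_gt0 ltr0n.
move: H; rewrite {}etaE {eta}.
move: (Num.sqrt n%:R) (Num.sqrt T%:R) nE TE p0 q0 => p q -> -> p0 q0.
have pq0 : 0 <= 2 / (p * q) by rewrite divr_ge0// mulr_ge0// ltW.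
have [p1 q1] : p != 0 /\ q != 0 by rewrite !gt_eqF.
move=> /(ler_wpM2l pq0).
have -> : 2 / (p * q) * (p / q / 2 * v) = (q ^+ 2)^-1 * v by field; rewrite ?p1 ?q1.
move=> /le_trans; apply.
(* The noise term comes out as L s/(pq), half of what the bound allows; this is exactly the
   difference of the two sides. *)
have Ls : 0 <= L * s / (p * q) by rewrite divr_ge0 ?mulr_ge0// ltW.
rewrite -subr_ge0; apply: (le_trans Ls); rewrite le_eqVlt; apply/orP; left; apply/eqP.
by field; rewrite ?p1 ?q1.
Qed.

Unset Implicit Arguments.

Theorem theoremB
  (R : realType) (d : nat)
  (* sample space of the data xi, and the node distributions D^(k) *)
  (dX : measure_display) (X : measurableType dX)
  (K : nat) (D : 'I_K -> probability X R)
  (* f^(k)(x; xi), its gradient nabla f^(k)(x; xi), f^(k), nabla f^(k) *)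
  (F : 'I_K -> 'rV[R]_d -> X -> R)
  (g : 'I_K -> 'rV[R]_d -> X -> 'rV[R]_d)
  (fk : 'I_K -> 'rV[R]_d -> R)
  (gradfk : 'I_K -> 'rV[R]_d -> 'rV[R]_d)
  (gradf : 'rV[R]_d -> 'rV[R]_d)
  (fstar L sigma zeta : R)
  (* underlying probability space and the minibatch samples *)
  (dO : measure_display) (Omega : measurableType dO) (P : probability Omega R)
  (b I T : nat) (xi : nat -> 'I_K -> 'I_b -> Omega -> X)
  (x1 : 'rV[R]_d) :
  (0 < K)%N -> (0 < b)%N -> (0 < I)%N -> (0 < T)%N -> (I %| T)%N ->
  0 <= L ->
  (* f^(k)(x) = E_{xi ~ D^(k)} [ f^(k)(x; xi) ] *)
  (forall k x, measurable_fun setT (F k x) /\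
     (D k).-integrable setT (fun z => (F k x z)%:E) /\
     (\int[D k]_z (F k x z)%:E = (fk k x)%:E)%E) ->
  (* nabla f^(k)(x; xi) is the gradient of x |-> f^(k)(x; xi) *)
  (forall k z, has_gradient (fun x => F k x z) (fun x => g k x z)) ->
  (* nabla f^(k) is the gradient of f^(k), nabla f the gradient of f *)
  (forall k, has_gradient (fk k) (gradfk k)) ->
  has_gradient (fglob fk) gradf ->
  (* f^* = inf f > -oo *)
  (forall x, fstar <= fglob fk x) ->
  (forall m, (forall x, m <= fglob fk x) -> m <= fstar) ->
  (* Assumption 1 *)
  (forall k x y,
     (\int[D k]_z (sqnorm (g k x z - g k y z))%:E <= (L ^+ 2 * sqnorm (x - y))%:E)%E) ->
  (* Assumption 2: unbiasedness, bounded variance, bounded heterogeneity *)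
  (forall k x (i : 'I_d), measurable_fun setT (fun z => g k x z 0 i) /\
     (D k).-integrable setT (fun z => (g k x z 0 i)%:E) /\
     (\int[D k]_z (g k x z 0 i)%:E = (gradfk k x 0 i)%:E)%E) ->
  (forall k x,
     (\int[D k]_z (sqnorm (g k x z - gradfk k x))%:E <= (sigma ^+ 2)%:E)%E) ->
  (forall k l x, sqnorm (gradfk k x - gradfk l x) <= zeta ^+ 2) ->
  (* regularity: the stochastic gradient is jointly measurable in (x, xi),
     in the sense that it maps measurable random inputs to measurable outputs *)
  (forall k (Z : Omega -> 'rV[R]_d) (Y : Omega -> X),
     (forall i, measurable_fun setT (fun w => Z w 0 i)) ->
     measurable_fun setT Y ->
     forall i, measurable_fun setT (fun w => g k (Z w) (Y w) 0 i)) ->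
  (* samples: measurable, xi_{t,k,j} ~ D^(k), all mutually independent *)
  (forall t k j, measurable_fun setT (xi t k j)) ->
  (forall A : 'I_T -> 'I_K -> 'I_b -> set X,
     (forall t k j, measurable (A t k j)) ->
     P [set w | forall (t : 'I_T) (k : 'I_K) (j : 'I_b), A t k j (xi t k j w)] =
     (\prod_(t < T) \prod_(k < K) \prod_(j < b) fine (D k (A t k j)))%:E) ->
  (* step size and horizon condition *)
  let eta := Num.sqrt ((b * K)%:R / T%:R) : R in
  81%:R * L ^+ 2 * (I ^ 2 * b * K)%:R <= T%:R ->
  let xbar := fun (t : nat) (w : Omega) =>
    avgK (fedavg I eta g x1 (fun t k j => xi t k j w) t) in
  (* E || nabla f(xbar_a) ||^2, a uniform on {1..T}; xbar (t-1) is xbar_t *)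
  (T%:R^-1%:E * \sum_(t < T) \int[P]_w (sqnorm (gradf (xbar t w)))%:E <=
   (2 * (fglob fk x1 - fstar) / (Num.sqrt (b * K)%:R * Num.sqrt T%:R)
    + 2 * L * sigma ^+ 2 / (Num.sqrt (b * K)%:R * Num.sqrt T%:R)
    + 3%:R * L ^+ 2 * (b * K)%:R * (I%:R - 1) / T%:R * sigma ^+ 2
    + 5%:R * L ^+ 2 * (b * K)%:R * (I%:R - 1) ^+ 2 / T%:R * zeta ^+ 2)%:E)%E.
Proof.
move=> K0 b0 I0 T0 IT L0 HF Fg fkg fg fstar_le _ smooth unbiased variance het _ mxi Pxi.
move=> eta HT; lazy beta zeta.
pose xbar t w := avgK (fedavg I eta g x1 (fun t k j => xi t k j w) t).
rewrite -[X in (_ * X <= _)%E]/(\sum_(t < T) \int[P]_w (sqnorm (gradf (xbar t w)))%:E)%E.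
have mF k x := (HF k x).1.
have TR : 0 < T%:R :> R by rewrite ltr0n.
have eta0 : 0 <= eta by exact: sqrtr_ge0.
have eta2 : eta ^+ 2 = (b * K)%:R / T%:R by rewrite sqr_sqrtr// divr_ge0.
have small : 81 * L ^+ 2 * I%:R ^+ 2 * eta ^+ 2 <= 1.
  rewrite eta2 mulrA ler_pdivrMr// mul1r; apply: le_trans HT.
  by rewrite !natrM le_eqVlt; apply/orP; left; apply/eqP; ring.
(* Since [I >= 1], the horizon condition gives even 81 (L eta)^2 <= 1. *)
have Leta : L * eta <= 1.
  have Le0 : 0 <= L * eta by rewrite mulr_ge0.
  have I1 : 1 <= I%:R ^+ 2 :> R by rewrite exprn_ege1// ler1n.
  have : (L * eta) ^+ 2 * 1 <= (L * eta) ^+ 2 * I%:R ^+ 2 by rewrite ler_wpM2l ?sqr_ge0.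
  move: small Le0; set e := L * eta.
  have -> : 81 * L ^+ 2 * I%:R ^+ 2 * eta ^+ 2 = 81 * (e ^+ 2 * I%:R ^+ 2) by rewrite /e; ring.
  nra.
(* Square-integrability of the gradient makes these integrals finite, so the claim becomes one about
   real numbers. *)
have int_t (t : 'I_T) : (\int[P]_w (sqnorm (gradf (xbar t w)))%:E =
    (Rintegral P setT (fun w => sqnorm (gradf (xbar t w))))%:E)%E.
  apply: EFin_Ex.
  exact: (L1_sqnorm_gradf_mean I x1 eta K0 b0 mF Fg fkg fg smooth unbiased variance mxi Pxi).
rewrite (eq_bigr _ (fun t _ => int_t t)) sumEFin -EFinM lee_fin.
apply: (@stepsize_bound R (b * K) T) => //; rewrite ?muln_gt0 ?b0 ?sqr_ge0//.
exact: (Ex_gradient_sum_le x1 K0 b0 I0 IT L0 mF Fg fkg fg fstar_le smooth unbiased variance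
  het mxi Pxi eta0 small Leta).
Qed.
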